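(* Let $\alpha,\beta>0$ and let $\rho_1,\rho_2$ be nonnegative, locally integrable functions on $\mathbb{R}^n$ such that $\rho_1$ is $s$-homogeneous and $\rho_2$ is $t$-homogeneous, where $s,t>-n$ satisfy $$\frac{\alpha}{\beta}=\frac{n+s}{n+t}.$$ Then the functional $$\mathcal{BS}_{\alpha,\beta,\rho_1,\rho_2}(\Phi)=\Bigl(\int_{\mathbb{R}^n} e^{-\alpha\Phi}\rho_1\,dx\Bigr)^{1/\alpha}\Bigl(\int_{\mathbb{R}^n} e^{-\beta\Phi^*}\rho_2\,dy\Bigr)^{1/\beta}$$ attains a maximum on the set of $1$-symmetric functions in $\mathcal{C}$.
   Context: $\mathcal{C}$ is the class of lower semicontinuous, even, convex functions $\Phi:\mathbb{R}^n\to\mathbb{R}\cup\{+\infty\}$ such that $\{\Phi<\infty\}$ has non-empty interior and $\lim_{|x|\to\infty}\Phi(x)=+\infty$. $\Phi\in\mathcal{C}$ is $1$-symmetric if $\Phi(x_1,\dots,x_n)=\Phi(\epsilon_1x_1,\dots,\epsilon_nx_n)=\Phi(x_{\sigma(1)},\dots,x_{\sigma(n)})$ for all $x$, all signs $\epsilon_i\in\{-1,1\}$ and all permutations $\sigma$. $\Phi^*(y)=\sup_x(\langle x,y\rangle-\Phi(x))$ is the Legendre transform. A function $\rho$ is $s$-homogeneous if $\rho(\lambda x)=\lambda^s\rho(x)$ for all $\lambda>0$ and $x\ne0$. *)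

(* Defs.v *)
From HB Require Import structures.
From mathcomp Require Import all_boot all_order all_algebra all_fingroup.
From mathcomp Require Import all_classical all_reals all_analysis.

Set Implicit Arguments.
Unset Strict Implicit.
Unset Printing Implicit Defensive.
Import Order.TTheory GRing.Theory Num.Theory.
Import numFieldNormedType.Exports.

Local Open Scope classical_set_scope.
Local Open Scope ring_scope.

(* R^d is 'rV[R]_n.+1 with d = n.+1 >= 1.

   The library only has Lebesgue measure on the line. On R^d we take the
   classical Lebesgue outer measure (infimum of the total volume of countable
   covers by half-open boxes) and the library's Caratheodory construction, so
   that "measurable" is Lebesgue (not merely Borel) measurability. *)
Section lebesgue_outer.
Context {R : realType} {n : nat}.
Local Notation E := 'rV[R]_n.+1.
Local Open Scope ereal_scope.

Definition box (c : E * E) : set E :=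
  [set x | forall i, x 0%R i \in `]c.1 0%R i, c.2 0%R i]%R].

Definition box_volume (c : E * E) : \bar R :=
  (\prod_i Num.max 0 (c.2 0 i - c.1 0 i))%R%:E.

Definition box_cover (X : set E) : set ((E * E)^nat) :=
  [set c | X `<=` \bigcup_k box (c k)].

Definition lebesgue_outer (X : set E) : \bar R :=
  ereal_inf [set \sum_(k <oo) box_volume (c k) | c in box_cover X].

Lemma box_volume_ge0 c : 0 <= box_volume c.
Proof.
by rewrite lee_fin; apply: prodr_ge0 => i _; rewrite le_max lexx.
Qed.
Hint Resolve box_volume_ge0 : core.

Lemma lebesgue_outer_ge0 X : 0 <= lebesgue_outer X.
Proof.
by apply: le_ereal_inf_tmp => _ [c _ <-]; exact: nneseries_ge0.
Qed.

Lemma lebesgue_outer0 : lebesgue_outer set0 = 0.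
Proof.
apply/eqP; rewrite eq_le lebesgue_outer_ge0 andbT.
apply: ereal_inf_lbound; exists (fun=> (0%R, 0%R)); first exact: sub0set.
rewrite eseries0// => k _ _; rewrite /box_volume /= big_ord_recl.
by rewrite subrr maxxx mul0r.
Qed.

Lemma le_lebesgue_outer : {homo lebesgue_outer : A B / A `<=` B >-> A <= B}.
Proof.
move=> A B AB; apply/ereal_inf_le_tmp => _ [c Bc <-].
by exists c => //; exact: subset_trans AB Bc.
Qed.

Lemma lebesgue_outer_sigma_subadditive : sigma_subadditive lebesgue_outer.
Proof.
move=> A; have [[i ioo]|] := pselect (exists i, lebesgue_outer (A i) = +oo).
  rewrite (eseries_pinfty _ _ ioo) ?leey// => k _.
  by rewrite -ltNye (lt_le_trans _ (lebesgue_outer_ge0 _)).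
rewrite -forallNE => Aoo.
suff add2e (e : {posnum R}) : lebesgue_outer (\bigcup_n A n) <=
    \sum_(i <oo) lebesgue_outer (A i) + e%:num%:E.
  by apply/lee_addgt0Pr => _/posnumP[].
rewrite (le_trans _ (epsilon_trick _ _ _))//; last first.
  by move=> k; exact: lebesgue_outer_ge0.
pose P k (c : (E * E)^nat) := box_cover (A k) c /\
  \sum_(j <oo) box_volume (c j) <=
    lebesgue_outer (A k) + (e%:num / (2 ^ k.+1)%:R)%:E.
have [G PG] : {G : ((E * E)^nat)^nat & forall k, P k (G k)}.
  apply: (@choice _ _ P) => k; rewrite /P /lebesgue_outer.
  set S := (X in ereal_inf X); move infS : (ereal_inf S) => iS.
  case: iS infS => [r Sr|Soo|Soo].
  - have en1 : (0 < e%:num / (2 ^ k.+1)%:R)%R by [].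
    have /(lb_ereal_inf_adherent en1) : ereal_inf S \is a fin_num by rewrite Sr.
    move=> [x [c Ac cx] xS].
    by exists c; split => //; rewrite cx -Sr; exact/ltW.
  - by have := Aoo k; rewrite /lebesgue_outer Soo.
  - suff : lbound S 0 by move/le_ereal_inf_tmp; rewrite Soo.
    by move=> /= _ [c _ <-]; exact: nneseries_ge0.
have volG_ge0 x : 0 <= (box_volume \o uncurry G) x by exact: box_volume_ge0.
apply: (@le_trans _ _ (\esum_(i in setT) (box_volume \o uncurry G) i)).
  apply: ereal_inf_lbound => /=.
  have /card_esym/ppcard_eqP[f] := card_nat2.
  exists (uncurry G \o f).
    move=> t [i _ /((PG i).1 _)[j _ Gijt]].
    by exists (f^-1%FUN (i, j)) => //=; rewrite invK ?inE.
  rewrite -(esum_pred_image (box_volume \o uncurry G) _ xpredT)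
    ?[fun=> _]set_true//.
  by rewrite image_eq.
rewrite (_ : esum _ _ = \sum_(i <oo) \sum_(j <oo) box_volume (G i j)); last first.
  pose J : nat -> set (nat * nat) := fun i => [set (i, j) | j in setT].
  rewrite (_ : setT = \bigcup_k J k); last first.
    by rewrite predeqE => -[a b]; split => // _; exists a => //; exists b.
  rewrite esum_bigcupT /=; last 2 first.
    - apply/trivIsetP => i j _ _ ij.
      rewrite predeqE => -[k m] /=; split => //= -[] [_] _ [<-{k} _].
      by move=> [m' _] [] /esym/eqP; rewrite (negbTE ij).
    - by move=> /= [k m]; exact: box_volume_ge0.
  rewrite -(image_id [set: nat]) -fun_true esum_pred_image//; last first.
    by move=> k _; exact: esum_ge0.
  apply: eq_eseriesr => /= j _.
  rewrite -(esum_pred_image (box_volume \o uncurry G) (pair j) predT)//=;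
    last by move=> ? ? _ _; exact: (@can_inj _ _ _ snd).
  by congr esum; rewrite predeqE => -[a b]; split; move=> [i _ <-]; exists i.
apply: lee_lim.
- apply: is_cvg_nneseries => k *.
  by apply: nneseries_ge0 => m *; exact: (volG_ge0 (k, m)).
- apply: is_cvg_nneseries => k *; apply: adde_ge0 => //.
  exact: lebesgue_outer_ge0.
- by near=> k; apply: lee_sum => i _; exact: (PG i).2.
Unshelve. all: by end_near. Qed.

HB.instance Definition _ := isOuterMeasure.Build R E lebesgue_outer
  lebesgue_outer0 lebesgue_outer_ge0 le_lebesgue_outer
  lebesgue_outer_sigma_subadditive.

Definition lebesgue_outer_measure : {outer_measure set E -> \bar R} :=
  lebesgue_outer.

End lebesgue_outer.

(* R^d with the sigma-algebra of Lebesgue measurable sets; convertible to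
   'rV[R]_n.+1. *)
Notation lebesgue_space R n :=
  (caratheodory_type (@lebesgue_outer_measure R n)).

Definition lebesgue {R : realType} {n : nat} :
    {measure set (lebesgue_space R n) -> \bar R} :=
  @lebesgue_outer_measure R n.

Section functions.
Context {R : realType} {n : nat}.
Local Notation E := 'rV[R]_n.+1.
Implicit Types (x y : E) (Phi : E -> \bar R) (rho : E -> R).

Definition dot x y : R := \sum_i x 0 i * y 0 i.

(* The library's norm on 'rV[R]_n.+1 is the sup norm. *)
Definition euclidean_norm x : R := Num.sqrt (dot x x).

(* Extended-real convexity; 0 * +oo = 0, so t = 0 and t = 1 are harmless. *)
Definition econvex Phi := forall x y (t : R), 0 <= t <= 1 ->
  (Phi (t *: x + (1 - t) *: y)%R <= t%:E * Phi x + (1 - t)%R%:E * Phi y)%E.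

Definition coercive Phi := forall M : R, exists r : R,
  forall x, r < euclidean_norm x -> (M%:E <= Phi x)%E.

Record in_classC Phi : Prop := InClassC {
  classC_gtNy : forall x, (-oo < Phi x)%E ;
  classC_lsc : lower_semicontinuous Phi ;
  classC_even : forall x, Phi (- x) = Phi x ;
  classC_convex : econvex Phi ;
  classC_interior : [set x | (Phi x < +oo)%E]° !=set0 ;
  classC_coercive : coercive Phi }.

Definition one_symmetric Phi :=
  (forall (eps : 'I_n.+1 -> R) x, (forall i, eps i = -1 \/ eps i = 1) ->
     Phi (\row_i (eps i * x 0 i)) = Phi x) /\
  (forall (sigma : 'S_n.+1) x, Phi (\row_i x 0 (sigma i)) = Phi x).

Definition legendre Phi : E -> \bar R :=
  fun y => ereal_sup [set ((dot x y)%:E - Phi x)%E | x in setT].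

Definition homogeneous (s : R) rho := forall (lambda : R) x,
  0 < lambda -> x != 0 -> rho (lambda *: x) = lambda `^ s * rho x.

Definition locally_integrableE rho :=
  measurable_fun [set: lebesgue_space R n] rho /\
  forall K : set E, compact K ->
    (\int[lebesgue]_(x in (K : set (lebesgue_space R n))) `|rho x|%:E < +oo)%E.

Definition BS (alpha beta : R) (rho1 rho2 : E -> R) Phi : \bar R :=
  ((\int[lebesgue]_(x in [set: lebesgue_space R n])
      (expeR (- (alpha%:E * Phi x)) * (rho1 x)%:E)) `^ (alpha^-1)%R *
   (\int[lebesgue]_(y in [set: lebesgue_space R n])
      (expeR (- (beta%:E * legendre Phi y)) * (rho2 y)%:E)) `^ (beta^-1)%R)%E.

End functions.

(* Main.v *)
Require Import Defs.
From HB Require Import structures.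
From mathcomp Require Import all_boot all_order all_algebra all_fingroup.
From mathcomp Require Import all_classical all_reals all_analysis.
From mathcomp Require Import measurable_realfun ring lra.

Set Implicit Arguments.
Unset Strict Implicit.
Unset Printing Implicit Defensive.
Import Order.TTheory GRing.Theory Num.Theory.
Import numFieldNormedType.Exports.
Local Open Scope classical_set_scope.
Local Open Scope ring_scope.

(* The direct method. Replacing Phi by x |-> Phi(l x) - c leaves BS unchanged (this is where the
   relation between alpha, beta, s and t enters), and a 1-symmetric convex Phi is nondecreasing
   in each |x_i|; so a maximising sequence Phi_k can be normalised to satisfy, for the sup norm,
   Phi_k >= |x| - 1 and Phi_k^* >= |y|/2 - 1. Both integrals are then dominated uniformly in k.
   Along a subsequence for which Phi_k converges at all rational points, the limits inferior F of
   Phi_k and g of Phi_k^* satisfy g^* <= F; since also g^** <= g, dominated convergence shows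
   that Phi0 = g^* is a maximiser. *)

(** The functional is invariant under one scalar dilation only, while a general even convex function
    may be wide in one direction and thin in another. 1-symmetry removes this obstacle: all axes
    carry the same profile, and monotonicity lets that profile control the function in every
    direction of the sup norm. The dilation is fixed by doubling: the profile, shifted to have
    minimum 0, passes the level 1 between 1/2 and 1, which is where the slope 1/2 in the bound for
    the transforms comes from.

    The limits inferior [F] and [g] need be neither convex nor lower semicontinuous, so neither is
    itself a candidate; a Legendre transform repairs both defects. Dominated convergence is applied
    to tail infima, which converge everywhere, so the sequences themselves are only required to
    converge at rational points. The dominating integrals are finite by a doubling inequality, which
    extracts decay at infinity from local integrability and homogeneity without polar
    coordinates. *)

(** * Lebesgue outer measure under cutting by hyperplanes and under dilation *)

Section half_space.
Context {R : realType} {n : nat}.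
Local Notation E := 'rV[R]_n.+1.
Implicit Types (c : E * E) (x : E) (X : set E) (i : 'I_n.+1) (a l : R).

Definition set_coord i a x : E := \row_j (if j == i then a else x 0 j).

(** Only the [i]-th edge changes, and the lengths of []lo, min hi a]] and []max lo a, hi]] add up to
    that of []lo, hi]]; when [a] lies outside, [Num.max 0] gives one piece length 0. *)
Lemma box_volume_split c i a :
  (box_volume (c.1, set_coord i (Num.min (c.2 0 i) a) c.2)%R +
   box_volume (set_coord i (Num.max (c.1 0 i) a) c.1, c.2)%R =
   box_volume c)%E.
Proof.
rewrite /box_volume -EFinD; congr EFin.
rewrite (bigD1 i)//= [X in _ + X](bigD1 i)//= [RHS](bigD1 i)//= !mxE !eqxx.
have e1 : \prod_(j < n.+1 | j != i) Num.max 0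
    ((set_coord i (Num.min (c.2 0 i) a) c.2) 0 j - c.1 0 j) =
    \prod_(j < n.+1 | j != i) Num.max 0 (c.2 0 j - c.1 0 j).
  by apply: eq_bigr => j /negbTE ji; rewrite mxE ji.
have e2 : \prod_(j < n.+1 | j != i) Num.max 0
    (c.2 0 j - (set_coord i (Num.max (c.1 0 i) a) c.1) 0 j) =
    \prod_(j < n.+1 | j != i) Num.max 0 (c.2 0 j - c.1 0 j).
  by apply: eq_bigr => j /negbTE ji; rewrite mxE ji.
rewrite e1 e2 -mulrDl; congr (_ * _).
rewrite /Num.max /Num.min.
by do ?case: ifPn; rewrite -?leNgt; lra.
Qed.

(** Cutting every box of a cover of [X] along the hyperplane [x_i = a] gives covers of the two parts
    of [X] with the same total volume. Boxes closed on the right match the closed half-space, so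
    both pieces are boxes of the same kind. *)
Lemma half_space_caratheodory i a :
  caratheodory_measurable (@lebesgue_outer_measure R n) [set x | x 0 i <= a].
Proof.
apply: le_caratheodory_measurable => X.
apply: le_ereal_inf_tmp => _ [c Xc <-].
have -> : (\sum_(k <oo) box_volume (c k) = \sum_(k <oo)
    (box_volume ((c k).1, set_coord i (Num.min ((c k).2 0 i) a) (c k).2)%R +
     box_volume (set_coord i (Num.max ((c k).1 0 i) a) (c k).1, (c k).2)%R))%E.
  by apply: eq_eseriesr => k _; rewrite box_volume_split.
rewrite nneseriesD; [|by move=> *; exact: box_volume_ge0..].
apply: leeD; apply: ereal_inf_lbound.
- exists (fun k => ((c k).1, set_coord i (Num.min ((c k).2 0 i) a) (c k).2)) => //.
  move=> x [Xx xa]; have [k _ xk] := Xc _ Xx; exists k => // j /=.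
  have := xk j; rewrite !in_itv/= mxE => /andP[-> xj]/=.
  by case: eqP => // ji; rewrite le_min -ji xj ji; exact: xa.
- exists (fun k => (set_coord i (Num.max ((c k).1 0 i) a) (c k).1, (c k).2)) => //.
  move=> x [Xx xa]; have [k _ xk] := Xc _ Xx; exists k => // j /=.
  have := xk j; rewrite !in_itv/= mxE => /andP[xj ->]; rewrite andbT.
  by case: eqP => // ji; rewrite gt_max -ji xj ltNge ji; exact/negP.
Qed.

Lemma box_caratheodory c :
  caratheodory_measurable (@lebesgue_outer_measure R n) (box c).
Proof.
have -> : box c = \bigcap_(k in [set: nat])
    [set x | (k < n.+1)%N -> c.1 0 (inord k) < x 0 (inord k) <= c.2 0 (inord k)].
  apply/seteqP; split => x /=.
    by move=> xc k _ /= _; have := xc (inord k); rewrite in_itv.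
  by move=> xc i; have /= := xc i I (ltn_ord i); rewrite in_itv inord_val.
apply: (@bigcap_measurableType _ (lebesgue_space R n)) => k _.
have [kn|kn] := ltnP k n.+1; last first.
  rewrite (_ : [set _ | _] = setT); first exact: measurableT.
  by apply/seteqP; split.
pose H a : set E := [set x | x 0 (inord k) <= a].
rewrite [X in measurable X](_ : _ = H (c.2 0 (inord k)) `\` H (c.1 0 (inord k))); last first.
  apply/seteqP; split => x /=.
    by move=> /(_ isT)/andP[h1 h2]; split => //; apply/negP; rewrite -ltNge.
  by move=> [h1 /negP]; rewrite -ltNge h1 andbT.
by apply: (@measurableD _ (lebesgue_space R n)); exact: half_space_caratheodory.
Qed.

Lemma lebesgue_outer_box c : (lebesgue_outer (box c) <= box_volume c)%E.
Proof.
apply: ereal_inf_lbound.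
exists (fun k => if k == 0%N then c else (0, 0)) => [x xc|]; first by exists 0%N.
rewrite nneseries_recl//; last by move=> k _; case: ifP => _; exact: box_volume_ge0.
rewrite eqxx eseries0 ?adde0//; case=> // k _ _.
by rewrite /box_volume /= big_ord_recl subrr maxxx mul0r.
Qed.

(** Homogeneity says nothing at the origin, so the change of variables for the weights needs the
    origin to be a null set. *)
Lemma lebesgue_outer_set1_0 : lebesgue_outer [set (0 : E)] = 0%E.
Proof.
apply/eqP; rewrite eq_le lebesgue_outer_ge0 andbT.
apply/lee_addgt0Pr => e e0; rewrite add0e.
(* The origin is the included corner; one edge has length [e] and the others 1, so the volume is
   [e]. *)
pose c : E * E := (\row_j (if j == 0 then - e else - 1), 0).
apply: (@le_trans _ _ (box_volume c)).
  apply: (le_trans _ (lebesgue_outer_box c)).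
  apply: le_lebesgue_outer => _ -> i; rewrite in_itv/= !mxE lexx andbT.
  by case: ifP => _; rewrite oppr_lt0 ?ltr01.
rewrite /box_volume lee_fin big_ord_recl/= !mxE/= big1 => [|j _].
  by rewrite mulr1 sub0r opprK ge_max lexx (ltW e0).
by rewrite !mxE/= sub0r opprK max_r.
Qed.

(** Shrinking a cover of [X] by [l^-1] covers the preimage. The opposite inequality is this one for
    [l^-1]. *)
Lemma lebesgue_outer_scale_le l X : 0 < l ->
  ((l ^+ n.+1)%:E * lebesgue_outer ((fun x => l *: x) @^-1` X) <=
   lebesgue_outer X)%E.
Proof.
move=> l0; have ln0 : 0 < l ^+ n.+1 by rewrite exprn_gt0.
apply: le_ereal_inf_tmp => _ [c Xc <-].
rewrite -lee_pdivlMl//.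
apply: (@le_trans _ _ (\sum_(k <oo)
    box_volume (l^-1 *: (c k).1, l^-1 *: (c k).2))%E).
  apply: ereal_inf_lbound.
  exists (fun k => (l^-1 *: (c k).1, l^-1 *: (c k).2)) => // x /= /Xc[k _ xk].
  exists k => // i; have := xk i; rewrite !in_itv/= !mxE.
  by rewrite ltr_pdivrMl// ler_pdivlMl.
rewrite le_eqVlt; apply/orP; left; apply/eqP.
rewrite -nneseriesZl; last by move=> *; exact: box_volume_ge0.
apply: eq_eseriesr => k _; rewrite /box_volume -EFinM; congr EFin.
rewrite -exprVn.
have -> : l^-1 ^+ n.+1 = \prod_(i < n.+1) l^-1 by rewrite prodr_const card_ord.
rewrite -big_split/=.
apply: eq_bigr => i _; rewrite !mxE -mulrBr.
by rewrite maxr_pMr ?mulr0// invr_ge0 ltW.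
Qed.

Lemma lebesgue_outer_scale l X : 0 < l ->
  ((l ^+ n.+1)%:E * lebesgue_outer ((fun x => l *: x) @^-1` X) =
   lebesgue_outer X)%E.
Proof.
move=> l0; apply/eqP; rewrite eq_le lebesgue_outer_scale_le//=.
have li0 : 0 < l^-1 by rewrite invr_gt0.
rewrite -lee_pdivrMl ?exprn_gt0// -exprVn.
apply: le_trans (lebesgue_outer_scale_le _ li0).
rewrite [X in (_ * lebesgue_outer X)%E](_ : _ = X)//.
apply/seteqP; split => x /=; by rewrite scalerA divff ?gt_eqF// scale1r.
Qed.

(** Outer measure scales by a constant factor, so the Caratheodory identity of the preimage tested
    on [Y] is that of [X] tested on the dilate of [Y] by [l]. *)
Lemma scale_outer_split l X Y : 0 < l ->
  (forall Z, lebesgue_outer Z =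
    (lebesgue_outer (Z `&` X) + lebesgue_outer (Z `&` ~` X))%E) ->
  (lebesgue_outer Y = lebesgue_outer (Y `&` (fun x => l *: x) @^-1` X) +
    lebesgue_outer (Y `&` (fun x => l *: x) @^-1` (~` X)))%E.
Proof.
move=> l0 mX.
have e (Z : set E) : lebesgue_outer Z =
    ((l ^+ n.+1)^-1%:E * lebesgue_outer ((fun x => (l^-1 *: x)%R) @^-1` Z))%E.
  by rewrite -(lebesgue_outer_scale Z (l:=l^-1)) ?invr_gt0// exprVn.
have eX A : (fun x : E => l^-1 *: x) @^-1` ((fun x => l *: x) @^-1` A) = A.
  by apply/seteqP; split => x /=; rewrite scalerA divff ?gt_eqF// scale1r.
rewrite (e Y) [X in _ = (X + _)%E]e [X in _ = (_ + X)%E]e mX.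
rewrite ge0_muleDr; [|exact: lebesgue_outer_ge0..].
by rewrite !preimage_setI !eX.
Qed.

Lemma scale_caratheodory l X : 0 < l ->
  caratheodory_measurable (@lebesgue_outer_measure R n) X ->
  caratheodory_measurable (@lebesgue_outer_measure R n)
    ((fun x => l *: x) @^-1` X).
Proof. by move=> l0 mX Y; exact: scale_outer_split. Qed.

End half_space.

(** * The sup norm through coordinates *)

Section sup_norm.
Context {R : realType} {n : nat}.
Local Notation E := 'rV[R]_n.+1.
Implicit Types (x : E) (i : 'I_n.+1) (r : R).

Lemma coord_le_norm x i : `|x 0 i| <= `|x|.
Proof.
rewrite [leRHS]/Num.norm/= mx_normrE.
by rewrite (le_bigmax _ (fun ij : 'I_1 * 'I_n.+1 => `|x ij.1 ij.2|) (0, i)).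
Qed.

Lemma norm_le x r : 0 <= r -> (forall i, `|x 0 i| <= r) -> `|x| <= r.
Proof.
move=> r0 xr; rewrite /Num.norm/= mx_normrE; apply: bigmax_le => //= -[j i] _ /=.
by rewrite ord1.
Qed.

Lemma norm_coord_max x : exists i, `|x| = `|x 0 i|.
Proof.
pose i := [arg max_(i > ord0) `|x 0 i|]%O.
exists i; apply/eqP; rewrite eq_le coord_le_norm andbT.
apply: norm_le => // j; rewrite /i; case: Order.TotalTheory.arg_maxP => //= k _.
exact.
Qed.

End sup_norm.

(** * Measurable sets and the change of variables for dilations *)

Section measurability.
Context {R : realType} {n : nat}.
Local Notation E := 'rV[R]_n.+1.
Local Notation T := (lebesgue_space R n).

Lemma open_lebesgue_measurable (U : set E) :
  open U -> measurable (U : set T).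
Proof.
move=> oU.
pose Q : Type := ('rV[rat]_n.+1 * 'rV[rat]_n.+1)%type.
pose B (q : Q) : set E := box (map_mx ratr q.1, map_mx ratr q.2).
rewrite (_ : U = \bigcup_q (if `[< B q `<=` U >] then B q else set0)).
  apply: (@countable_bigcupT_measurable _ T Q).
    exact: countableP.
  move=> q; case: ifPn => _; last exact: (@measurable0 _ T).
  exact: box_caratheodory.
apply/seteqP; split => [x Ux|x [q _]]; last first.
  by case: ifPn => // /asboolP; exact.
have /nbhs_ballP[e /= e0 eU] : nbhs x U by exact: open_nbhs_nbhs.
have lo i : {q : rat | x 0 i - e < ratr q < x 0 i}.
  apply: cid; have /rat_in_itvoo[q] : x 0 i - e < x 0 i by rewrite ltrBlDr ltrDl.
  by rewrite in_itv/=; exists q.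
have hi i : {q : rat | x 0 i < ratr q < x 0 i + e}.
  apply: cid; have /rat_in_itvoo[q] : x 0 i < x 0 i + e by rewrite ltrDl.
  by rewrite in_itv/=; exists q.
(* Both corners are rational and within [e] of [x] in every coordinate, so the box lies in the
   sup-norm ball. *)
exists (\row_i sval (lo i), \row_i sval (hi i)) => //.
rewrite ifT.
  move=> i; rewrite in_itv/= !mxE.
  by have /andP[_ ->] := svalP (lo i); have /andP[/ltW -> _] := svalP (hi i).
apply/asboolP => y yB; apply: eU; split => // i j; rewrite ord1.
have := yB j; rewrite in_itv/= !mxE => /andP[h1 h2].
have /andP[h3 _] := svalP (lo j); have /andP[_ h4] := svalP (hi j).
rewrite /ball/= ltr_norml; apply/andP; split; lra.
Qed.

Lemma lsc_lebesgue_measurable (f : E -> \bar R) :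
  lower_semicontinuous f -> measurable_fun [set: T] (f : T -> \bar R).
Proof.
move=> scif; apply: (measurability _ (ErealGenOInfty.measurableE R)).
move=> /= _ [_ [a ->]] <-; apply: (@measurableI _ T) => //.
apply: open_lebesgue_measurable.
by rewrite preimage_itvoy; move/lower_semicontinuousP : scif; exact.
Qed.

Lemma scale_measurable (l : R) : 0 < l ->
  measurable_fun [set: T] ((fun x : E => l *: x) : T -> T).
Proof.
move=> l0 _ A mA; rewrite setTI; exact: scale_caratheodory.
Qed.

Lemma measurable_set1_0 : measurable ([set 0 : E] : set T).
Proof.
rewrite -[X in measurable X]setCK; apply: (@measurableC _ T).
apply: open_lebesgue_measurable; rewrite openC.
exact/accessible_closed_set1/hausdorff_accessible/norm_hausdorff.
Qed.

Lemma lebesgue_scale (l : R) (A : set T) : 0 < l ->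
  lebesgue ((fun x : E => l *: x) @^-1` A) =
  ((l ^+ n.+1)^-1%:E * lebesgue A)%E.
Proof.
move=> l0; change (lebesgue_outer ((fun x : E => l *: x) @^-1` A) =
  ((l ^+ n.+1)^-1%:E * lebesgue_outer A)%E).
rewrite -(lebesgue_outer_scale A l0) muleA -EFinM mulVf ?mul1e//.
by rewrite expf_neq0// gt_eqF.
Qed.

(** The pushforward of Lebesgue measure under the dilation agrees on measurable sets with a multiple
    of Lebesgue measure, which reduces the formula to integration against a pushforward. *)
Lemma ge0_integral_scale (l : R) (h : T -> \bar R) : 0 < l ->
  measurable_fun [set: T] h -> (forall x, 0 <= h x)%E ->
  (\int[lebesgue]_(x in [set: T]) h ((l *: (x : E))%R : E) =
   (l ^+ n.+1)^-1%:E * \int[lebesgue]_(x in [set: T]) h x)%E.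
Proof.
move=> l0 mh h0; have k0 : 0 <= (l ^+ n.+1)^-1.
  by rewrite invr_ge0 exprn_ge0// ltW.
have ml := scale_measurable l0.
rewrite -[RHS](@ge0_integral_mscale _ _ _ lebesgue _ _ (NngNum k0))//.
transitivity (\int[pushforward (lebesgue : set T -> \bar R)
    ((fun x : E => l *: x) : T -> T)]_(x in [set: T]) h x)%E.
  by rewrite ge0_integral_pushforward.
apply: eq_measure_integral => A mA _.
exact: lebesgue_scale.
Qed.

End measurability.

(** * The extended exponential: measurability and limits *)

Section expeR.
Context {R : realType}.
Local Open Scope ereal_scope.

Lemma measurable_expeR d (T : measurableType d) (f : T -> \bar R) :
  measurable_fun setT f -> measurable_fun setT (fun x => expeR (f x)).
Proof.
move=> mf; apply: (measurability _ (ErealGenOInfty.measurableE R)).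
move=> /= _ [_ [a ->]] <-; rewrite setTI preimage_itvoy.
have [a0|a0] := leP 0 a%:E.
  rewrite (_ : [set x | _] = f @^-1` `]lne a%:E, +oo]).
    by rewrite -[X in measurable X]setTI; apply: mf => //; exact: emeasurable_itv.
  have la : expeR (lne a%:E) = a%:E by rewrite lneK// in_itv/= a0 leey.
  apply/seteqP; split => x /=; rewrite in_itv/= leey andbT.
    by rewrite -[X in X < _]la lte_expeR.
  by rewrite -lte_expeR la.
rewrite (_ : [set x | _] = setT)//; apply/seteqP; split => x //= _.
by rewrite (lt_le_trans a0)// expeR_ge0.
Qed.

(** In the application [u] is a negative multiple of a sequence bounded below, so its limit is never
    [+oo]. The limit [-oo] is the value [+oo] of a convex function, where the exponential must tend
    to 0. *)
Lemma expeR_cvg (u : (\bar R)^nat) (l : \bar R) : l < +oo ->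
  u @ \oo --> l -> expeR (u k) @[k --> \oo] --> expeR l.
Proof.
case: l => [l _|//|_] ul.
  have [ufin fu] := (fine_cvgP _ _).1 ul.
  have e : {near \oo, (fun k => (expR (fine (u k)))%:E) =1 (fun k => expeR (u k))}.
    by near=> k; rewrite -[in RHS](@fineK _ (u k))//; near: k.
  apply: cvg_trans (near_eq_cvg e) _.
  apply: cvg_EFin; first exact: nearW.
  by apply: continuous_cvg fu; exact: continuous_expR.
move/cvgeNyPle : ul => ul; rewrite [X in _ --> X]/=.
have small (e : R) : (0 < e)%R -> \forall k \near \oo, expeR (u k) <= e%:E.
  move=> e0; near=> k; rewrite -(lnK (x:=e)) ?posrE//.
  by rewrite -[leRHS]/(expeR (ln e)%:E) lee_expeR; near: k; exact: ul.
apply/fine_cvgP; split.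
  near=> k; rewrite ge0_fin_numE ?expeR_ge0//.
  by apply: (@le_lt_trans _ _ 1); [near: k; exact: small|rewrite ltry].
apply/cvgrPdist_le => e e0; near=> k.
have ue : expeR (u k) <= e%:E by near: k; exact: small.
have := expeR_ge0 (u k); rewrite sub0r normrN /=.
by case: (expeR (u k)) ue => //= r; rewrite !lee_fin => re r0; rewrite ger0_norm.
Unshelve. all: by end_near. Qed.

End expeR.

(** * Integrals against a weight *)

Section weighted_integral.
Context d (T : measurableType d) {R : realType}.
Implicit Types (c : R) (G H : T -> \bar R).

(** The weight stays a factor of the integrand, as in [BS], so that [BS] is convertible to an
    expression in these integrals. *)
Definition wint (mu : {measure set T -> \bar R}) (rho : T -> R) G : \bar R :=
  (\int[mu]_(x in [set: T]) (G x * (rho x)%:E))%E.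

Definition nonneg_measurable G :=
  measurable_fun [set: T] G /\ forall x, (0 <= G x)%E.

Variables (mu : {measure set T -> \bar R}) (rho : T -> R).
Hypothesis rho_ge0 : forall x, 0 <= rho x.
Hypothesis mrho : measurable_fun [set: T] rho.

Lemma nonneg_measurable_weight G : nonneg_measurable G ->
  nonneg_measurable (fun x => G x * (rho x)%:E)%E.
Proof.
move=> [mG G0]; split => [|x]; last by rewrite mule_ge0// lee_fin.
by apply: emeasurable_funM => //; exact/measurable_EFinP.
Qed.

Lemma ge0_integral_ae_Zl c G H (N : set T) : 0 <= c ->
  nonneg_measurable G -> nonneg_measurable H ->
  measurable N -> mu N = 0%E -> (forall x, ~ N x -> G x = c%:E * H x)%E ->
  (\int[mu]_(x in [set: T]) G x = c%:E * \int[mu]_(x in [set: T]) H x)%E.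
Proof.
move=> c0 [mG G0] [mH H0] mN N0 GH; rewrite -ge0_integralZl//.
apply: ge0_ae_eq_integral => //.
- exact: measurable_funeM.
- by move=> x _; rewrite mule_ge0// lee_fin.
exists N; split=> // x /= /not_implyP[_]; apply: contra_notP => Nx.
exact: GH.
Qed.

Lemma wint_ge0 G : (forall x, 0 <= G x)%E -> (0 <= wint mu rho G)%E.
Proof.
by move=> G0; apply: integral_ge0 => x _; rewrite mule_ge0// lee_fin.
Qed.

Lemma le_wint G H : nonneg_measurable G -> nonneg_measurable H ->
  (forall x, G x <= H x)%E -> (wint mu rho G <= wint mu rho H)%E.
Proof.
move=> /nonneg_measurable_weight[mG G0] /nonneg_measurable_weight[mH H0] GH.
apply: ge0_le_integral => // x _.
by apply: lee_wpmul2r => //; rewrite lee_fin.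
Qed.

Lemma wintD G H : nonneg_measurable G -> nonneg_measurable H ->
  wint mu rho (fun x => G x + H x)%E = (wint mu rho G + wint mu rho H)%E.
Proof.
move=> nG nH; have [mG G0] := nonneg_measurable_weight nG.
have [mH H0] := nonneg_measurable_weight nH.
rewrite /wint -ge0_integralD//.
by apply: eq_integral => x _; rewrite ge0_muleDl//; [case: nG|case: nH].
Qed.

Lemma wintZ c G : 0 <= c -> nonneg_measurable G ->
  wint mu rho (fun x => c%:E * G x)%E = (c%:E * wint mu rho G)%E.
Proof.
move=> c0 nG; have [mG G0] := nonneg_measurable_weight nG.
rewrite /wint -ge0_integralZl//.
by apply: eq_integral => x _; rewrite muleA.
Qed.

Lemma wint_dominated_cvg (G_ : (T -> \bar R)^nat) G H :
  (forall k, nonneg_measurable (G_ k)) -> nonneg_measurable G ->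
  nonneg_measurable H -> (wint mu rho H < +oo)%E ->
  (forall k x, G_ k x <= H x)%E ->
  (forall x, G_ k x @[k --> \oo] --> G x) ->
  wint mu rho (G_ k) @[k --> \oo] --> wint mu rho G.
Proof.
move=> nG_ nG nH Hoo GH cG.
have [mH H0] := nonneg_measurable_weight nH.
have [mG G0] := nonneg_measurable_weight nG.
have nG_w k := nonneg_measurable_weight (nG_ k).
have [] // := @dominated_convergence _ T R mu setT measurableT
  (fun k x => G_ k x * (rho x)%:E)%E (fun x => G x * (rho x)%:E)%E
  (fun x => H x * (rho x)%:E)%E.
- by move=> k; case: (nG_w k).
- by apply: aeW => x _; apply: cvgeZr.
- apply/integrableP; split=> //.
  by under eq_integral do rewrite gee0_abs//.
- apply: aeW => x k _; rewrite gee0_abs; last by case: (nG_w k).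
  by apply: lee_wpmul2r => //; rewrite lee_fin.
Qed.

End weighted_integral.
Arguments wint {d T R} mu rho G.

(** * Homogeneous weights and exhaustion of the space *)

Section weight.
Context {R : realType} {n : nat}.
Local Notation E := 'rV[R]_n.+1.
Local Notation T := (lebesgue_space R n).

Record weight (s : R) (rho : E -> R) : Prop := Weight {
  weight_ge0 : forall x, 0 <= rho x ;
  weight_int : locally_integrableE rho ;
  weight_hom : homogeneous s rho ;
  weight_gt : - n.+1%:R < s }.

Variables (s : R) (rho : E -> R).
Hypothesis w : weight s rho.
Implicit Types (l r c : R) (G H : T -> \bar R).

Let rho_ge0 : forall x : T, 0 <= rho x := weight_ge0 w.

Lemma weight_measurable : measurable_fun [set: T] (rho : T -> R).
Proof. by case: (weight_int w). Qed.

Lemma scale_nonneg_measurable l G : 0 < l -> nonneg_measurable G ->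
  nonneg_measurable (fun x : T => G ((l *: (x : E)) : E)).
Proof.
by move=> l0 [mG G0]; split=> //; apply: measurableT_comp mG (scale_measurable l0).
Qed.

(** Substituting [l x] produces the Jacobian factor with exponent [- n.+1] and, by homogeneity of
    the weight, a further factor with exponent [- s]. *)
Lemma wint_scale l G : 0 < l -> nonneg_measurable G ->
  wint lebesgue rho (fun x : T => G ((l *: (x : E)) : E)) =
  ((l `^ (- (s + n.+1%:R)))%:E * wint lebesgue rho G)%E.
Proof.
move=> l0 nG; have [mGl Gl0] := scale_nonneg_measurable l0 nG.
pose h (x : T) := (G x * (rho x)%:E)%E.
have [mh h0] := nonneg_measurable_weight rho_ge0 weight_measurable nG.
transitivity ((l `^ (- s))%:E *
    \int[lebesgue]_(x in [set: T]) h ((l *: (x : E))%R : E))%E; last first.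
  rewrite ge0_integral_scale// opprD powRD; last by rewrite (gt_eqF l0) implybT.
  by rewrite [X in (_ * X)%:E]powRN powR_mulrn ?ltW// EFinM -muleA.
have mhl : measurable_fun [set: T] (fun x : T => h ((l *: (x : E)) : E)).
  by apply: measurableT_comp mh (scale_measurable l0).
have nGl := scale_nonneg_measurable l0 nG.
(* The exceptional null set is the origin, which [homogeneous] leaves out. *)
apply: (ge0_integral_ae_Zl (powR_ge0 _ _) (N := [set (0 : E)] : set T)).
- exact: (nonneg_measurable_weight rho_ge0 weight_measurable nGl).
- by split=> // x; exact: h0.
- exact: measurable_set1_0.
- exact: lebesgue_outer_set1_0.
move=> x /eqP x0.
rewrite /h (weight_hom w)// muleCA -EFinM mulrA -powRD ?(gt_eqF l0) ?implybT//.
by rewrite addNr powRr0 mul1r.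
Qed.

End weight.

Section wint_exhaustion.
Context d (T : measurableType d) {R : realType}.
Variables (mu : {measure set T -> \bar R}) (rho : T -> R).
Hypothesis rho_ge0 : forall x, 0 <= rho x.
Hypothesis mrho : measurable_fun [set: T] rho.

Lemma nonneg_measurable_indic (A : set T) (G : T -> \bar R) : measurable A ->
  nonneg_measurable G -> nonneg_measurable (fun x => (\1_A x)%:E * G x)%E.
Proof.
move=> mA [mG G0]; split => [|x]; last by rewrite mule_ge0// lee_fin.
by apply: emeasurable_funM => //; apply/measurable_EFinP; exact: measurable_indic.
Qed.

Lemma nonneg_measurableD (G H : T -> \bar R) : nonneg_measurable G ->
  nonneg_measurable H -> nonneg_measurable (fun x => G x + H x)%E.
Proof.
move=> [mG G0] [mH H0]; split=> [|x]; last exact: adde_ge0.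
exact: emeasurable_funD.
Qed.

Lemma nonneg_measurableZ (c : R) (G : T -> \bar R) : 0 <= c ->
  nonneg_measurable G -> nonneg_measurable (fun x => c%:E * G x)%E.
Proof.
move=> c0 [mG G0]; split=> [|x]; last exact: mule_ge0.
exact: measurable_funeM.
Qed.

Lemma wint_exhaustion (B : (set T)^nat) (G : T -> \bar R) (M : \bar R) :
  nondecreasing_seq B -> (forall k, measurable (B k)) ->
  \bigcup_k B k = [set: T] -> nonneg_measurable G ->
  (forall k, wint mu rho (fun x => (\1_(B k) x)%:E * G x)%E <= M)%E ->
  (wint mu rho G <= M)%E.
Proof.
move=> ndB mB BT nG GM.
have [mG G0] := nonneg_measurable_weight rho_ge0 mrho nG.
have := @ge0_nondecreasing_set_cvg_integral _ _ _ B
  (fun x => G x * (rho x)%:E)%E mu ndB mB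
  (fun i => measurable_funS measurableT (@subsetT _ _) mG)
  (fun i x _ => G0 x).
rewrite BT => cB; rewrite /wint -(cvg_lim _ cB)//.
apply: lime_le; first by apply/cvg_ex; eexists; exact: cB.
apply: nearW => k; apply: le_trans (GM k).
rewrite integral_mkcond epatch_indic /wint.
rewrite le_eqVlt; apply/orP; left; apply/eqP.
by apply: eq_integral => x _ /=; rewrite muleC muleA.
Qed.

Definition gibbs (a : R) (f : T -> \bar R) (x : T) : \bar R :=
  expeR (- (a%:E * f x))%E.

Lemma nonneg_measurable_gibbs a f : measurable_fun [set: T] f ->
  nonneg_measurable (gibbs a f).
Proof.
move=> mf; split=> [|x]; last exact: expeR_ge0.
apply: measurable_expeR; apply: measurableT_comp => //.
exact: measurable_funeM.
Qed.

End wint_exhaustion.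

(** * Integrability of a decaying exponential of the norm *)

Section exp_norm.
Context {R : realType} {n : nat}.
Local Notation E := 'rV[R]_n.+1.
Local Notation T := (lebesgue_space R n).
Local Notation N := (fun x : T => `|x : E|%:E).
Variables (s : R) (rho : E -> R).
Hypothesis w : weight s rho.
Let rho_ge0 : forall x : T, 0 <= rho x := weight_ge0 w.
Let mrho := weight_measurable w.

Definition cball0 (r : R) : set T := [set x : E | `|x| <= r].

Lemma closed_cball0 r : closed (cball0 r : set E).
Proof.
have -> : cball0 r = (fun x : E => `|x|) @^-1` [set y | y <= r] by [].
by apply: closed_comp; [move=> x _; exact: norm_continuous|exact: closed_le].
Qed.

Lemma measurable_cball0 r : measurable (cball0 r).
Proof.
rewrite -[X in measurable X]setCK; apply: measurableC.
by apply: open_lebesgue_measurable; rewrite openC; exact: closed_cball0.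
Qed.

Lemma wint_cball0_lty r :
  (wint lebesgue (rho : T -> R) (fun x => (\1_(cball0 r) x)%:E) < +oo)%E.
Proof.
have := (weight_int w).2 (cball0 r) (bounded_closed_compact _ (@closed_cball0 r)).
have bB : bounded_set (cball0 r : set E).
  by exists r; split; [exact: num_real|move=> y ry x /le_trans; apply; exact: ltW].
move=> /(_ bB); apply: le_lt_trans.
rewrite integral_mkcond epatch_indic /wint le_eqVlt; apply/orP; left; apply/eqP.
apply: eq_integral => x _; rewrite muleC ger0_norm//; exact: weight_ge0 w _.
Qed.

Lemma measurable_enorm : measurable_fun [set: T] N.
Proof.
apply: (lsc_lebesgue_measurable (f := fun x : E => `|x|%:E)).
apply/lower_semicontinuousP => a.
have -> : [set x : E | a%:E < `|x|%:E]%E = (fun x : E => `|x|) @^-1` [set y | y > a].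
  by apply/seteqP; split => x /=; rewrite lte_fin.
by apply: open_comp; [move=> x _; exact: norm_continuous|exact: open_gt].
Qed.

(** Self-similarity replaces polar coordinates. Doubling the variable costs the fixed factor [p],
    whereas [exp(-2c|x|)] is a small multiple of [exp(-c|x|)] outside a fixed ball. Hence the
    integral over the ball of radius [2r] is at most a fraction of the one over radius [r] plus a
    constant, and it also dominates the latter. *)
Lemma wint_exp_norm_lty c : 0 < c ->
  (wint lebesgue (rho : T -> R) (gibbs c N) < +oo)%E.
Proof.
move=> c0; pose p := 2 `^ (s + n.+1%:R); have p0 : 0 < p by rewrite powR_gt0.
pose e := (p * 2)^-1; have e0 : 0 < e by rewrite invr_gt0 mulr_gt0.
(* Beyond the radius [U] one has [exp(-c|x|) <= e]. *)
pose U := - ln e / c.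
pose G r (x : T) := ((\1_(cball0 r) x)%:E * gibbs c N x)%E.
pose I r := wint lebesgue (rho : T -> R) (G r).
pose K := wint lebesgue (rho : T -> R) (fun x => (\1_(cball0 U) x)%:E).
have ng := nonneg_measurable_gibbs c measurable_enorm.
have nG r : nonneg_measurable (G r).
  exact: (nonneg_measurable_indic (@measurable_cball0 r) ng).
have nB r : nonneg_measurable (fun x : T => (\1_(cball0 r) x : R)%:E).
  split=> [|x]; last by rewrite lee_fin.
  by apply/measurable_EFinP; apply: measurable_indic; exact: measurable_cball0.
have g1 x : (gibbs c N x <= 1)%E.
  by rewrite -expeR0 lee_expeR oppe_le0 lee_fin mulr_ge0// ltW.
have G2 (r : R) (x : T) : (G (2 * r)%R (2 *: (x : E) : E)%R <=
    e%:E * G r x + (\1_(cball0 U) x)%:E)%E.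
  have e0' : (0 <= e%:E * G r x)%E.
    by apply: mule_ge0; [rewrite lee_fin ltW|case: (nG r)].
  have [xU|Ux] := leP `|x : E| U.
    rewrite [X in (_ + X)%E](_ : _ = 1%E); last by rewrite indicE mem_set.
    apply: (@le_trans _ _ 1%E); last by rewrite leeDr.
    by rewrite /G indicE; case: (_ \in _); rewrite ?mul1e// mul0e.
  have nx2 : `|2 *: (x : E)| = 2 * `|x : E| by rewrite normrZ ger0_norm.
  have -> : G (2 * r)%R (2 *: (x : E) : E)%R = ((\1_(cball0 r) x)%:E *
      expeR (- (c%:E * (2 * `|x : E|)%:E)))%E.
    rewrite /G /gibbs nx2 !indicE; congr (_%:R%:E * _)%E; congr nat_of_bool.
    apply/idP/idP => [/set_mem|/set_mem] h; apply: mem_set; move: h; rewrite /cball0/=.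
      by rewrite nx2 ler_pM2l.
    by rewrite nx2 ler_pM2l.
  rewrite /G indicE.
  case: (x \in cball0 r); last by rewrite !mul0e mule0 add0e lee_fin.
  rewrite !mul1e -[leLHS]adde0; apply: leeD; last by rewrite lee_fin.
  rewrite /gibbs/= lee_fin.
  have -> : - (c * (2 * `|x : E|)) = - (c * `|x : E|) + - (c * `|x : E|).
    by rewrite -opprD; congr (- _); ring.
  rewrite expRD ler_wpM2r ?expR_ge0// -[leRHS](@lnK R)// ler_expR lerNl.
  by rewrite -ler_pdivrMl// mulrC ltW.
(* The truncation to balls serves this finiteness: only a finite [I r] can be absorbed into the
   left-hand side. *)
have Ifin r : I r \is a fin_num.
  rewrite ge0_fin_numE; last by apply: wint_ge0 => //; case: (nG r).
  apply: le_lt_trans (wint_cball0_lty r); apply: le_wint => // x.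
  by rewrite /G indicE; case: (_ \in _); rewrite ?mul1e// mul0e.
have I2 r : 0 <= r -> (I r <= I (2 * r)%R)%E.
  move=> r0; apply: le_wint => // x; apply: lee_wpmul2r; first by case: ng.
  rewrite lee_fin !indicE; case: (boolP (x \in cball0 r)) => // /set_mem/= xr.
  have -> // : x \in cball0 (2 * r).
  by apply: mem_set; apply: (le_trans xr); rewrite ler_peMl// ler1n.
(* As p * e = 1/2, this bounds I r by 2 * p * K uniformly in r. *)
have Ihalf r : 0 <= r -> (I r <= p%:E * (e%:E * I r + K))%E.
  move=> r0; apply: (le_trans (I2 _ r0)).
  have nG2 := scale_nonneg_measurable (ltr0n R 2) (nG (2 * r)).
  have nH := nonneg_measurableZ (ltW e0) (nG r).
  have := wint_scale w (ltr0n R 2) (nG (2 * r)).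
  rewrite -/(I (2 * r)) powRN -/p => /(congr1 (fun z => p%:E * z)%E).
  rewrite muleA -EFinM divff ?gt_eqF// mul1e => <-.
  apply: lee_wpmul2l; first by rewrite lee_fin ltW.
  rewrite -(wintZ _ _ _ (ltW e0) (nG r))// -(wintD _ _ _ nH (nB U))//.
  exact: (le_wint _ rho_ge0 mrho nG2 (nonneg_measurableD nH (nB U)) (G2 r)).
apply: (@le_lt_trans _ _ (2 * p * fine K)%:E); last exact: ltry.
apply: (@wint_exhaustion _ T _ _ _ _ _ (fun k => cball0 k%:R)) => //.
- by move=> i j ij; apply/subsetPset => x /= /le_trans; apply; rewrite ler_nat.
- by move=> k; exact: measurable_cball0.
- apply/seteqP; split => // x _; exists (Num.bound `|x : E|) => //=.
  by apply/ltW/archi_boundP.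
move=> k; have {Ihalf} := Ihalf k%:R (ler0n _ _).
have Kfin : K \is a fin_num.
  by rewrite ge0_fin_numE ?wint_cball0_lty//; apply: wint_ge0 => //; case: (nB U).
move: (Ifin k%:R) Kfin; rewrite -/(I k%:R).
case: (I k%:R) => // i _; case: K => // q _; rewrite -EFinM !lee_fin/= /e.
rewrite mulrDr mulrA.
have -> : p * (p * 2)^-1 = 2^-1 by rewrite invfM mulrA divff ?gt_eqF// mul1r.
lra.
Qed.

End exp_norm.

(** * The Legendre transform *)

Section legendre.
Context {R : realType} {n : nat}.
Local Notation E := 'rV[R]_n.+1.
Implicit Types (x y : E) (f g : E -> \bar R).

Lemma dotC x y : dot x y = dot y x.
Proof. by apply: eq_bigr => i _; rewrite mulrC. Qed.

Lemma dotZl (l : R) x y : dot (l *: x) y = l * dot x y.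
Proof. by rewrite /dot mulr_sumr; apply: eq_bigr => i _; rewrite mxE mulrA. Qed.

Lemma dotDl x x' y : dot (x + x') y = dot x y + dot x' y.
Proof. by rewrite /dot -big_split; apply: eq_bigr => i _; rewrite mxE mulrDl. Qed.

Lemma dot_set_coord (i : 'I_n.+1) (a : R) y : dot (set_coord i a 0) y = a * y 0 i.
Proof.
rewrite /dot (bigD1 i)//= mxE eqxx big1 ?addr0// => j /negbTE ji.
by rewrite !mxE ji mul0r.
Qed.

Lemma dot_le_norm x y : dot x y <= n.+1%:R * `|x| * `|y|.
Proof.
apply: (@le_trans _ _ (\sum_(i < n.+1) `|x| * `|y|)).
  apply: ler_sum => i _; apply: (le_trans (ler_norm _)).
  by rewrite normrM ler_pM// coord_le_norm.
by rewrite sumr_const card_ord -mulrA mulr_natl.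
Qed.

Lemma dot_continuous x : continuous (dot x : E -> R).
Proof.
apply: continuous_big => [|i _ y]; first by move=> z; apply: cvgD; [exact: cvg_fst|exact: cvg_snd].
by apply: continuousM; [exact: cst_continuous|exact: coord_continuous].
Qed.

Lemma legendre_ge f x y : ((dot x y)%:E - f x <= legendre f y)%E.
Proof. by apply: ereal_sup_ubound; exists x. Qed.

Lemma legendre_le f y (c : \bar R) :
  (forall x, (dot x y)%:E - f x <= c)%E -> (legendre f y <= c)%E.
Proof. by move=> h; apply: ge_ereal_sup => _ [x _ <-]; exact: h. Qed.

Lemma legendre_legendre_le f y : (legendre (legendre f) y <= f y)%E.
Proof.
apply: legendre_le => x; have := legendre_ge f y x; rewrite dotC.
case: (f y) => [r| |] /=; case: (legendre f x) => [q| |] //=;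
  rewrite ?leey// ?leNye// -?EFinD ?lee_fin; lra.
Qed.

Lemma legendre_gtNy f y : (exists x, f x < +oo)%E -> (-oo < legendre f y)%E.
Proof.
move=> [x]; have := legendre_ge f x y.
case: (f x) => [r| |]//=.
  by move=> h _; apply: lt_le_trans h; rewrite -EFinD ltNyr.
by move=> h _; apply: lt_le_trans h.
Qed.

(** A strict superlevel set of a supremum is the union of those of the affine functions; each is
    open, being empty when [f x = +oo] and everything when [f x = -oo]. *)
Lemma legendre_lsc f : lower_semicontinuous (legendre f).
Proof.
apply/lower_semicontinuousP => a.
have -> : [set y | a%:E < legendre f y]%E =
    \bigcup_x [set y | a%:E < (dot x y)%:E - f x]%E.
  apply/seteqP; split => y /=.
    by move=> /ereal_sup_gt[_ [x _ <-] h]; exists x.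
  by move=> [x _ /= h]; apply: lt_le_trans h _; exact: legendre_ge.
apply: bigcup_open => x _.
case: (f x) => [r| |].
- have -> : [set y | a%:E < (dot x y)%:E - r%:E]%E =
     (dot x) @^-1` [set z | z > a + r].
    by apply/seteqP; split => y /=; rewrite -EFinD lte_fin; lra.
  by apply: open_comp; [move=> y _; exact: dot_continuous|exact: open_gt].
- rewrite (_ : [set _ | _] = set0); first exact: open0.
  by apply/seteqP; split => y.
- rewrite (_ : [set _ | _] = setT); first exact: openT.
  by apply/seteqP; split => y //= _; rewrite ltry.
Qed.

Lemma legendre_convex f : (forall x, -oo < f x)%E -> (exists x, f x < +oo)%E ->
  econvex (legendre f).
Proof.
move=> fNy fx x y t /andP[t0 t1]; apply: legendre_le => z.
have := legendre_ge f z x; have := legendre_ge f z y.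
have := legendre_gtNy x fx; have := legendre_gtNy y fx.
have -> : dot z (t *: x + (1 - t) *: y) = t * dot z x + (1 - t) * dot z y.
  by rewrite dotC dotDl !dotZl !(dotC z).
have := fNy z; case: (f z) => [r _| |]//=; last by move=> *; exact: leNye.
(* At the endpoints [0 * +oo = 0] enters the inequality; for [0 < t < 1] an infinite value of the
   transform makes the right-hand side [+oo]. *)
have [->|tn0] := eqVneq t 0.
  by rewrite !mul0r mul0e subr0 !mul1r !add0r mul1e ?add0e => _ _ h.
have [->|tn1] := eqVneq t 1.
  by rewrite subrr !mul0r mul0e !mul1r !addr0 mul1e ?adde0 => _ _ _ h.
have t_gt0 : 0 < t by rewrite lt_def tn0.
have t_lt1 : 0 < 1 - t by rewrite subr_gt0 lt_neqAle tn1.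
move: (legendre f x) (legendre f y) => [p| |] [q| |]//= _ _;
  rewrite ?gt0_muley ?lte_fin// -?EFinM ?addye ?addey ?leey//.
rewrite -!EFinD !lee_fin => yq xp.
have h1 := ler_wpM2l t0 xp; have h2 := ler_wpM2l (ltW t_lt1) yq; lra.
Qed.

(** Sign changes and permutations preserve [dot], so they can be moved onto the variable of the
    supremum. *)
Lemma legendre_one_symmetric f : one_symmetric f -> one_symmetric (legendre f).
Proof.
move=> [fs fp]; split.
  move=> eps y epsE; have ee i : eps i * eps i = 1.
    by case: (epsE i) => ->; rewrite ?mulrNN mulr1.
  have d x : dot x (\row_i (eps i * y 0 i)) = dot (\row_i (eps i * x 0 i)) y.
    by apply: eq_bigr => i _; rewrite !mxE mulrCA mulrA.
  apply/eqP; rewrite eq_le; apply/andP; split; apply: legendre_le => x.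
    by rewrite d -(fs eps x)//; exact: legendre_ge.
  rewrite -(fs eps x)//; have -> : dot x y = dot (\row_i (eps i * x 0 i)) (\row_i (eps i * y 0 i)).
    by apply: eq_bigr => i _; rewrite !mxE mulrACA ee mul1r.
  exact: legendre_ge.
move=> sg y.
have d x : dot (\row_i x 0 (sg i)) (\row_i y 0 (sg i)) = dot x y.
  rewrite [RHS]/dot (reindex_inj (@perm_inj _ sg))/=.
  by apply: eq_bigr => i _; rewrite !mxE.
apply/eqP; rewrite eq_le; apply/andP; split; apply: legendre_le => x.
  have -> : x = \row_i (\row_j x 0 (sg^-1 j)%g) 0 (sg i).
    by apply/rowP => i; rewrite !mxE permK.
  by rewrite d fp; exact: legendre_ge.
by rewrite -d -(fp sg); exact: legendre_ge.
Qed.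

Lemma legendre_affine f (l c : R) y : 0 < l ->
  legendre (fun x => f (l *: x) - c%:E)%E y = (legendre f (l^-1 *: y) + c%:E)%E.
Proof.
move=> l0; have e x : ((dot x y)%:E - (f (l *: x) - c%:E) =
    (dot (l *: x) (l^-1 *: y))%:E - f (l *: x) + c%:E)%E.
  have -> : dot (l *: x) (l^-1 *: y) = dot x y.
    by rewrite dotZl dotC dotZl mulrA divff ?gt_eqF// mul1r dotC.
  case: (f (l *: x)) => [r| |]//=.
  rewrite -!EFinD; congr EFin; ring.
apply/eqP; rewrite eq_le; apply/andP; split.
  apply: legendre_le => x; rewrite e; apply: leeD => //; exact: legendre_ge.
rewrite -leeBrDr//; apply: legendre_le => x.
rewrite leeBrDr//.
have -> : x = l *: (l^-1 *: x) by rewrite scalerA divff ?gt_eqF// scale1r.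
rewrite -(e (l^-1 *: x)).
exact: (legendre_ge (fun x => f (l *: x) - c%:E)%E).
Qed.

End legendre.

(** * Monotonicity of 1-symmetric convex functions in each absolute coordinate *)

Section unconditional.
Context {R : realType} {n : nat}.
Local Notation E := 'rV[R]_n.+1.
Variable f : E -> \bar R.
Hypotheses (fNy : forall x, (-oo < f x)%E) (fc : econvex f)
  (fs : one_symmetric f).

Lemma one_symmetric_even (x : E) : f (- x) = f x.
Proof.
rewrite -(fs.1 (fun=> -1) x); last by move=> i; left.
by congr f; apply/rowP => i; rewrite !mxE mulN1r.
Qed.

(** The modified point lies on the segment from [x] to its reflection in the [i]-th coordinate, and
    [f] has the same value at both ends. *)
Lemma set_coord_le i (a : R) (x : E) : `|a| <= `|x 0 i| -> (f (set_coord i a x) <= f x)%E.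
Proof.
have [xi0|xi0] := eqVneq (x 0 i) 0.
  rewrite xi0 normr0 normr_le0 => /eqP ->.
  suff -> : set_coord i 0 x = x by [].
  by apply/rowP => j; rewrite mxE; case: eqP => // ->.
(* The solution of [t x_i - (1 - t) x_i = a]. *)
move=> axi; pose t := (1 + a / x 0 i) / 2.
have : `|a / x 0 i| <= 1 by rewrite normrM normfV ler_pdivrMr ?normr_gt0// mul1r.
rewrite ler_norml => /andP[q1 q2].
have t01 : 0 <= t <= 1 by rewrite /t; apply/andP; split; lra.
have -> : set_coord i a x =
    t *: x + (1 - t) *: (\row_j ((if j == i then -1 else 1) * x 0 j)).
  apply/rowP => j; rewrite !mxE; case: eqP => [->|_]; last by ring.
  by rewrite /t; field.
apply: (le_trans (fc _ _ t01)).
rewrite (fs.1 (fun j => if j == i then -1 else 1)); last first.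
  by move=> j; case: eqP => _; [left|right].
have /andP[t0 t1] := t01.
have := fNy x; case: (f x) => [r| |]//= _; last by rewrite leey.
by rewrite -!EFinM -EFinD lee_fin le_eqVlt; apply/orP; left; apply/eqP; ring.
Qed.

Lemma unconditional_le (z x : E) : (forall i, `|z 0 i| <= `|x 0 i|) -> (f z <= f x)%E.
Proof.
(* Coordinates are exchanged one at a time: [h] runs from [x] to [z]. *)
move=> zx; pose h k : E := \row_(j < n.+1) (if (j < k)%N then z 0 j else x 0 j).
have hk k : (k <= n.+1)%N -> (f (h k) <= f x)%E.
  elim: k => [_|k ih kn].
    suff -> : h 0%N = x by [].
    by apply/rowP => j; rewrite mxE.
  apply: le_trans (ih (ltnW kn)); pose i := Ordinal kn.
  have -> : h k.+1 = set_coord i (z 0 i) (h k).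
    apply/rowP => j; rewrite !mxE ltnS leq_eqVlt.
    have [->|ji] := eqVneq j i; first by rewrite /= eqxx.
    by rewrite -[(j : nat) == k]/(j == i) (negbTE ji).
  by apply: set_coord_le; rewrite mxE ltnn.
suff <- : h n.+1 = z by exact: hk.
by apply/rowP => j; rewrite mxE ltn_ord.
Qed.

Lemma set_coord_sym i j (r : R) : f (set_coord i r 0) = f (set_coord j r 0).
Proof.
rewrite -(fs.2 (tperm i j)); congr f; apply/rowP => k; rewrite !mxE.
case: tpermP => [->|->|/eqP ki /eqP kj].
- by rewrite eq_sym.
- by rewrite !eqxx.
- by rewrite (negbTE ki) (negbTE kj).
Qed.

End unconditional.

(** * Normalization by a dilation and a shift *)

Section normalization.
Context {R : realType} {n : nat}.
Local Notation E := 'rV[R]_n.+1.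
Implicit Types (f : E -> \bar R).

(** [normalized_ge] bounds [f] from below, and [normalized_half] is what bounds its transform from
    below. The constants come from an axis profile with minimum 0 that passes the level 1 between
    1/2 and 1. *)
Record normalized f : Prop := Normalized {
  normalized_lsc : lower_semicontinuous f ;
  normalized_sym : one_symmetric f ;
  normalized_mono : forall z x : E,
    (forall i, `|z 0 i| <= `|x 0 i|) -> (f z <= f x)%E ;
  normalized_ge : forall x : E, ((`|x| - 1)%:E <= f x)%E ;
  normalized_half : forall i, (f (set_coord i 2^-1 0) <= 1)%E }.

Lemma normalized_legendre_ge f y : normalized f ->
  ((`|y| / 2 - 1)%:E <= legendre f y)%E.
Proof.
move=> nf; have [i ->] := norm_coord_max y.
(* The supremum is tested on the axis of the largest [|y_i|], at distance 1/2 on the side where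
   [y_i] pairs positively. *)
pose e : R := if 0 <= y 0 i then 2^-1 else - 2^-1.
have fe : (f (set_coord i e 0) <= 1)%E.
  apply: le_trans (normalized_half nf i); apply: normalized_mono => // j.
  rewrite !mxE; case: eqP => // _; rewrite /e; case: ifP => // _.
  by rewrite normrN.
apply: le_trans (legendre_ge f (set_coord i e 0) y); rewrite dot_set_coord.
have -> : e * y 0 i = `|y 0 i| / 2.
  rewrite /e; case: ifPn => [y0|]; first by rewrite ger0_norm// mulrC.
  by rewrite -ltNge => y0; rewrite ltr0_norm// mulrC mulrN mulNr.
by rewrite EFinB; apply: leeB.
Qed.

(** The pairing is at most [|x|] while [f] is at least [|x| - 1]. The bound survives the limit
    inferior of the transforms and there yields the coercivity of the maximiser. *)
Lemma normalized_legendre_axis f i (e : R) : normalized f -> `|e| <= 1 ->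
  (legendre f (set_coord i e 0) <= 1)%E.
Proof.
move=> nf e1; apply: legendre_le => x; rewrite dotC dot_set_coord.
apply: (@le_trans _ _ (`|x|%:E - (`|x| - 1)%:E)%E).
  apply: leeB; last exact: normalized_ge.
  rewrite lee_fin (le_trans (ler_norm _))// normrM.
  by rewrite (le_trans (ler_pM _ _ e1 (coord_le_norm x i)))// mul1r.
by rewrite -EFinB lee_fin; lra.
Qed.

Lemma set_coordZ i (a l : R) : l *: (set_coord i a 0 : E) = set_coord i (l * a) 0.
Proof. by apply/rowP => j; rewrite !mxE; case: ifP => // _; rewrite mulr0. Qed.

Lemma euclidean_norm_set_coord i (a : R) :
  euclidean_norm (set_coord i a 0 : E) = `|a|.
Proof. by rewrite /euclidean_norm dot_set_coord !mxE eqxx -expr2 sqrtr_sqr. Qed.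

Lemma econvexZ f (x : E) (t : R) : econvex f -> 0 <= t <= 1 ->
  (f (t *: x) <= t%:E * f x + (1 - t)%R%:E * f 0%R)%E.
Proof. by move=> fc t01; have := fc x 0 t t01; rewrite scaler0 addr0. Qed.

(** An interior point of the domain can be moved so that its first coordinate is nonzero;
    monotonicity then discards the other coordinates. *)
Lemma classC_axis_lty f : in_classC f -> one_symmetric f ->
  exists2 r : R, 0 < r & (f (set_coord ord0 r 0) < +oo)%E.
Proof.
move=> fC fs; have [z /nbhs_ballP[e /= e0 eU]] := classC_interior fC.
pose a := if z 0 ord0 == 0 then e / 2 else z 0 ord0.
have a0 : a != 0 by rewrite /a; case: ifPn => // _; rewrite gt_eqF// divr_gt0.
exists `|a|; first by rewrite normr_gt0.
apply: (@le_lt_trans _ _ (f (set_coord ord0 a z))).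
  apply: unconditional_le => //; [exact: classC_gtNy fC|exact: classC_convex fC|].
  by move=> j; rewrite !mxE; case: ifP => // _; rewrite ?normr_id// normr0.
apply: eU; split => // i j; rewrite ord1 mxE /ball/=.
case: eqP => [->|_]; last by rewrite subrr normr0.
rewrite /a; case: eqP => [->|_]; last by rewrite subrr normr0.
by rewrite sub0r normrN gtr0_norm ?divr_gt0// ltr_pdivrMr// ltr_pMr// ltr1n.
Qed.

Lemma normalization f : in_classC f -> one_symmetric f ->
  exists l c : R, 0 < l /\ normalized (fun x => f (l *: x) - c%:E)%E.
Proof.
move=> fC fs; have fNy := classC_gtNy fC; have fc := classC_convex fC.
have mono := unconditional_le fNy fc fs.
have [r r0 fr] := classC_axis_lty fC fs.
have f0min x : (f 0%R <= f x)%E by apply: mono => i; rewrite mxE normr0.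
have [c fc0] : exists c, f 0 = c%:E.
  have := fNy 0; have := le_lt_trans (f0min _) fr.
  by case: (f 0) => // c; exists c.
have cmin x : (c%:E <= f x)%E by rewrite -fc0.
pose p (a : R) := f (set_coord ord0 a 0).
have pconv (t a : R) : 0 <= t <= 1 -> (p (t * a)%R <= t%:E * p a + ((1 - t) * c)%R%:E)%E.
  by move=> t01; rewrite /p -set_coordZ; have := econvexZ (set_coord ord0 a 0) fc t01;
    rewrite fc0 -EFinM.
have [r1 r10 pr1] : exists2 r1, 0 < r1 & (p r1 <= (c + 1)%:E)%E.
  move: fr (fNy (set_coord ord0 r 0)) (cmin (set_coord ord0 r 0)); rewrite -/(p r).
  have := pconv _ r; case: (p r) => [q| |]// pq _ _; rewrite lee_fin => cq.
  (* Convexity bounds the profile at [t * r] by [c + t * (q - c)], and this [t] makes the excess at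
     most 1. *)
  pose t := (1 + (q - c))^-1; have q1 : 0 < 1 + (q - c) by lra.
  have t01 : 0 <= t <= 1.
    by rewrite /t invr_ge0 ltW//= invf_le1//; lra.
  have t0 : 0 < t by rewrite invr_gt0.
  exists (t * r); first by rewrite mulr_gt0.
  apply: le_trans (pq _ t01) _; rewrite -EFinM -EFinD lee_fin.
  have -> : t * q + (1 - t) * c = c + (q - c) * t by ring.
  rewrite lerD2l /t ler_pdivrMr//; lra.
(* Doubling [r1] eventually crosses the level [c + 1], by coercivity. The least exponent is positive
   because [r1] has not crossed, so the first point above the level serves as [l], and [l / 2] is
   still at most at the level. *)
have exk : exists k : nat, ((c + 1)%:E < p (2 ^+ k * r1)%R)%E.
  have [M hM] := classC_coercive fC (c + 2).
  exists (Num.bound `|M / r1|); set k := Num.bound _.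
  apply: (@lt_le_trans _ _ (c + 2)%:E); first by rewrite lte_fin; lra.
  apply: hM; rewrite euclidean_norm_set_coord ger0_norm; last first.
    by rewrite mulr_ge0// ?exprn_ge0// ltW.
  rewrite -ltr_pdivrMr//; apply: (le_lt_trans (ler_norm _)).
  apply: (lt_trans (archi_boundP (normr_ge0 _))).
  by rewrite -natrX ltr_nat ltn_expl.
have [k Pk kmin] := ex_minnP exk.
case: k Pk kmin => [|k] Pk kmin.
  by move: Pk; rewrite expr0 mul1r ltNge pr1.
have Pk' : (p (2 ^+ k * r1)%R <= (c + 1)%:E)%E.
  by rewrite leNgt; apply/negP => /kmin; rewrite ltnn.
pose l := 2 ^+ k.+1 * r1; have l0 : 0 < l by rewrite mulr_gt0// exprn_gt0.
exists l, c; split => //; split.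
- apply/lower_semicontinuousP => a.
  have -> : [set x | a%:E < f (l *: x) - c%:E]%E =
     (fun x : E => l *: x) @^-1` [set x | (a + c)%:E < f x]%E.
    by apply/seteqP; split => x; rewrite /preimage/mkset EFinD lteBrDr.
  apply: open_comp; first by move=> x _; exact: scaler_continuous.
  by have /lower_semicontinuousP := classC_lsc fC; exact.
- split=> [eps x epsE|sg x]; congr (_ - _)%E.
    rewrite -[RHS](fs.1 eps)//; congr f; apply/rowP => i; rewrite !mxE; ring.
  by rewrite -[RHS](fs.2 sg)//; congr f; apply/rowP => i; rewrite !mxE.
- move=> z x zx; apply: leeB => //; apply: mono => i; rewrite !mxE !normrM.
  by rewrite ler_wpM2l.
- move=> x; have [i xi] := norm_coord_max x.
  rewrite leeBrDr// -EFinD.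
  have [x1|x1] := leP `|x| 1.
    by apply: le_trans (cmin _); rewrite lee_fin; lra.
  have x0 : 0 < `|x| by rewrite (lt_trans _ x1).
  apply: (@le_trans _ _ (p (l * `|x|)%R)); last first.
    rewrite /p (set_coord_sym fs ord0 i); apply: mono => j; rewrite !mxE.
    case: eqP => [->|_]; last by rewrite normr0.
    by rewrite !normrM normr_id xi.
  (* The axis point [l] lies on the segment from 0 to [l * |x|] with weight [1/|x|]. As the profile
     exceeds [c + 1] at [l], convexity makes it exceed [c + |x|] at the far end. *)
  have t01 : 0 <= `|x|^-1 <= 1 by rewrite invr_ge0 ltW//= invf_le1// ltW.
  have := pconv _ (l * `|x|)%R t01.
  rewrite mulrCA mulVf ?gt_eqF// mulr1 => /(lt_le_trans Pk).
  have := fNy (set_coord ord0 (l * `|x|)%R 0); rewrite -/(p _).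
  case: (p _) => [q| |]// _; last by rewrite leey.
  rewrite -EFinM -EFinD lte_fin lee_fin => h.
  have : `|x| * (c + 1) < `|x| * (`|x|^-1 * q + (1 - `|x|^-1) * c).
    by rewrite ltr_pM2l.
  have -> : `|x| * (`|x|^-1 * q + (1 - `|x|^-1) * c) = q + (`|x| - 1) * c.
    by field; rewrite gt_eqF.
  by move=> hq; lra.
- move=> i; rewrite leeBlDr// set_coordZ (set_coord_sym fs i ord0).
  have -> : l * 2^-1 = 2 ^+ k * r1 by rewrite /l exprS; field.
  by rewrite addeC -EFinD.
Qed.

End normalization.

(** * Invariance of the functional and uniform bounds *)

Section affine_invariance.
Context {R : realType} {n : nat}.
Local Notation E := 'rV[R]_n.+1.
Local Notation T := (lebesgue_space R n).
Implicit Types (f : E -> \bar R).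

Definition gibbs_integral (a : R) (rho : E -> R) f : \bar R :=
  wint lebesgue (rho : T -> R) (gibbs a (f : T -> \bar R)).

Lemma BSE (alpha beta : R) (rho1 rho2 : E -> R) f :
  BS alpha beta rho1 rho2 f = (gibbs_integral alpha rho1 f `^ alpha^-1 *
    gibbs_integral beta rho2 (legendre f) `^ beta^-1)%E.
Proof. by []. Qed.

Lemma expeR_shift (a c : R) (u : \bar R) : 0 < a ->
  expeR (- (a%:E * (u - c%:E))) =
  ((expR (a * c))%:E * expeR (- (a%:E * u)))%E.
Proof.
move=> a0; case: u => [u| |].
- by rewrite /= -EFinM -expRD; congr (expR _)%:E; ring.
- by rewrite /= gt0_muley ?lte_fin//= mule0.
- by rewrite /= gt0_muleNy ?lte_fin//= gt0_muley// lte_fin expR_gt0.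
Qed.

Lemma gibbs_integral_affine (s a l c : R) (rho : E -> R) f :
  weight s rho -> lower_semicontinuous f -> 0 < a -> 0 < l ->
  gibbs_integral a rho (fun x => f (l *: x) - c%:E)%E =
  ((expR (a * c - (s + n.+1%:R) * ln l))%:E * gibbs_integral a rho f)%E.
Proof.
move=> w flsc a0 l0.
have ng : nonneg_measurable (gibbs a (f : T -> \bar R)).
  by apply: nonneg_measurable_gibbs; exact: lsc_lebesgue_measurable.
have -> : expR (a * c - (s + n.+1%:R) * ln l) =
    expR (a * c) * l `^ (- (s + n.+1%:R)).
  by rewrite /powR gt_eqF// -expRD mulNr.
have mw := weight_measurable w.
have w0 : forall x : T, 0 <= rho x := weight_ge0 w.
rewrite EFinM -muleA -(wint_scale w l0 ng).
rewrite -(wintZ lebesgue w0 mw (expR_ge0 _) (scale_nonneg_measurable l0 ng)).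
congr wint; apply/funext => x; exact: expeR_shift.
Qed.

Lemma gibbs_integral_ge0 (s a : R) (rho : E -> R) f :
  weight s rho -> (0 <= gibbs_integral a rho f)%E.
Proof.
by move=> w; apply: wint_ge0 => x; [exact: weight_ge0 w _|exact: expeR_ge0].
Qed.

Lemma le_gibbs_integral (s a : R) (rho : E -> R) (f g : E -> \bar R) :
  weight s rho -> 0 < a ->
  measurable_fun [set: T] (f : T -> \bar R) ->
  measurable_fun [set: T] (g : T -> \bar R) ->
  (forall x, f x <= g x)%E ->
  (gibbs_integral a rho g <= gibbs_integral a rho f)%E.
Proof.
move=> w a0 mf mg fg.
apply: (le_wint lebesgue (weight_ge0 w : forall x : T, 0 <= rho x)
  (weight_measurable w) (nonneg_measurable_gibbs a mg)
  (nonneg_measurable_gibbs a mf)) => x.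
by rewrite lee_expeR leeN2 lee_pmul2l ?lte_fin.
Qed.

(** The exponent is the lower bound for the transforms and also lies below [|x| - 1], so one
    dominating function serves both integrals. *)
Definition gibbs_bound (a : R) (rho : E -> R) : \bar R :=
  gibbs_integral a rho (fun x => (`|x| / 2 - 1)%:E).

Lemma measurable_half_norm :
  measurable_fun [set: T] ((fun x : E => (`|x| / 2 - 1)%:E) : T -> \bar R).
Proof.
apply: (lsc_lebesgue_measurable (f := fun x : E => (`|x| / 2 - 1)%:E)).
apply/lower_semicontinuousP => a.
have -> : [set x : E | a%:E < (`|x| / 2 - 1)%:E]%E =
    (fun x : E => `|x|) @^-1` [set y | y > (a + 1) * 2].
  by apply/seteqP; split => x /=; rewrite lte_fin; lra.
by apply: open_comp; [move=> x _; exact: norm_continuous|exact: open_gt].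
Qed.

Lemma gibbs_bound_lty (s a : R) (rho : E -> R) : weight s rho -> 0 < a ->
  (gibbs_bound a rho < +oo)%E.
Proof.
move=> w a0; have a20 : 0 < a / 2 by rewrite divr_gt0.
have := wint_exp_norm_lty w a20; rewrite /gibbs_bound /gibbs_integral.
have -> : gibbs a ((fun x : E => (`|x| / 2 - 1)%:E) : T -> \bar R) = (fun x : T =>
    (expR a)%:E * gibbs (a / 2) (fun x : T => `|x : E|%:E) x)%E.
  by apply/funext => x; rewrite /gibbs/= -EFinM -expRD; congr (expR _)%:E; field.
have mw := weight_measurable w.
have w0 : forall x : T, 0 <= rho x := weight_ge0 w.
have ng := nonneg_measurable_gibbs (a / 2) (@measurable_enorm R n).
move=> h; have e := wintZ lebesgue w0 mw (expR_ge0 a) ng.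
rewrite [X in (X < _)%E](_ : _ = ((expR a)%:E * wint lebesgue (rho : T -> R)
  (gibbs (a / 2) (fun x : T => `|x : E|%:E)))%E); last exact: e.
by rewrite lte_mul_pinfty ?lee_fin ?expR_ge0.
Qed.

Section BS.
Variables (alpha beta s t : R) (rho1 rho2 : E -> R).
Hypotheses (alpha_gt0 : 0 < alpha) (beta_gt0 : 0 < beta).
Hypotheses (w1 : weight s rho1) (w2 : weight t rho2).
Hypothesis ratio : alpha / beta = (n.+1%:R + s) / (n.+1%:R + t).
Local Notation BS := (BS alpha beta rho1 rho2).

(** The transform turns the pair [(l, c)] into [(l^-1, -c)]. After the powers [1/alpha] and [1/beta]
    the shifts cancel, and the powers of [l] cancel because [ratio] amounts to
    [(d + s) / alpha = (d + t) / beta] with [d = n.+1]. *)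
Lemma BS_affine f (l c : R) : lower_semicontinuous f -> 0 < l ->
  BS (fun x => f (l *: x) - c%:E)%E = BS f.
Proof.
move=> flsc l0.
have li0 : 0 < l^-1 by rewrite invr_gt0.
have eleg : legendre (fun x => f (l *: x) - c%:E)%E =
    (fun y => legendre f (l^-1 *: y) - (- c)%:E)%E.
  by apply/funext => y; rewrite legendre_affine// EFinN oppeK.
rewrite !BSE eleg (gibbs_integral_affine _ w1)//.
rewrite (gibbs_integral_affine _ w2)//; last exact: legendre_lsc.
set k1 := expR _; set k2 := expR _.
have k10 : 0 <= k1 by exact: expR_ge0.
have k20 : 0 <= k2 by exact: expR_ge0.
rewrite !poweRM ?lee_fin//; last 2 first.
- exact: gibbs_integral_ge0 w2.
- exact: gibbs_integral_ge0 w1.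
rewrite muleACA !poweR_EFin -EFinM.
suff -> : k1 `^ alpha^-1 * k2 `^ beta^-1 = 1 by rewrite mul1e.
rewrite /powR !gt_eqF ?expR_gt0// !expRK -expRD -[RHS]expR0; congr expR.
rewrite lnV//.
(* The lower bound on [t] makes the quotient in [ratio] a genuine one, not a division by 0 with
   default value 0. *)
have nt : n.+1%:R + t != 0.
  by rewrite gt_eqF// -ltrBlDl sub0r; exact: weight_gt w2.
have e : (n.+1%:R + s) / alpha = (n.+1%:R + t) / beta.
  have -> : n.+1%:R + s = alpha / beta * (n.+1%:R + t) by rewrite ratio divfK.
  by field; rewrite !gt_eqF.
have -> : alpha^-1 * (alpha * c - (s + n.+1%:R) * ln l) = c - (n.+1%:R + s) / alpha * ln l.
  by field; rewrite gt_eqF.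
have -> : beta^-1 * (beta * - c - (t + n.+1%:R) * - ln l) = - c + (n.+1%:R + t) / beta * ln l.
  by field; rewrite gt_eqF.
by rewrite e; ring.
Qed.

Lemma normalized_gibbs_le f : normalized f ->
  (gibbs_integral alpha rho1 f <= gibbs_bound alpha rho1)%E /\
  (gibbs_integral beta rho2 (legendre f) <= gibbs_bound beta rho2)%E.
Proof.
move=> nf; split.
  apply: (le_gibbs_integral w1 alpha_gt0 measurable_half_norm
    (lsc_lebesgue_measurable (normalized_lsc nf))) => x.
  apply: le_trans (normalized_ge nf x); rewrite lee_fin.
  by have := normr_ge0 x; lra.
apply: (le_gibbs_integral w2 beta_gt0 measurable_half_norm
  (lsc_lebesgue_measurable (@legendre_lsc R n f))) => y.
exact: normalized_legendre_ge.
Qed.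

End BS.
End affine_invariance.

(** * Real limits, subsequences and rational approximation *)

Section selection.
Context {R : realType}.

(** The limit 0 is included since a limiting integral may vanish; there monotonicity of the power
    replaces the logarithm. *)
Lemma powR_cvg (u : nat -> R) (l r : R) : 0 < r -> (forall k, 0 <= u k) ->
  u @ \oo --> l -> u k `^ r @[k --> \oo] --> l `^ r.
Proof.
move=> r0 u0 ul.
have : 0 <= l.
  by rewrite -(cvg_lim _ ul)//; apply: limr_ge; [apply/cvg_ex; exists l|exact: nearW].
rewrite le_eqVlt => /predU1P[l0|l0].
  rewrite -l0 powR0 ?gt_eqF//; apply/cvgrPdist_le => e e0; near=> k.
  rewrite sub0r normrN ger0_norm ?powR_ge0//.
  have -> : e = (e `^ r^-1) `^ r by rewrite -powRrM mulVf ?gt_eqF// powRr1// ltW.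
  apply: ge0_ler_powR; rewrite ?nnegrE ?powR_ge0//; first exact: ltW.
  rewrite -[leLHS]ger0_norm// -normrN -sub0r l0; near: k.
  by move/cvgrPdist_le : ul; apply; rewrite powR_gt0.
have e : {near \oo, (fun k => expR (r * ln (u k))) =1 (fun k => u k `^ r)}.
  near=> k; rewrite /powR gt_eqF//; near: k.
  by have /cvgr_gt := ul; apply.
have -> : l `^ r = expR (r * ln l) by rewrite /powR gt_eqF.
apply: cvg_trans (near_eq_cvg e) _.
apply: continuous_cvg; first exact: continuous_expR.
apply: cvgMr; apply: continuous_cvg ul; exact: continuous_ln.
Unshelve. all: by end_near. Qed.

(** An ultrafilter finer than [\oo] makes all coordinate sequences converge at once, by compactness
    of [[0, b]]. Each [S m] imposes finitely many conditions, so it belongs to the ultrafilter and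
    is nonempty; [phi m] is one of its elements. *)
Lemma diagonal_selection (I : countType) (v : nat -> I -> R) (b : R) :
  (forall k i, 0 <= v k i <= b) ->
  exists phi : nat -> nat, (forall m, (m <= phi m)%N) /\
    forall i, exists l : R, v (phi m) i @[m --> \oo] --> l.
Proof.
move=> vb.
have [G [GU sG]] := @ultraFilterLemma nat \oo _.
have hl i : {l : R | v^~ i @ G --> l}.
  apply: cid.
  have vG : (v^~ i @ G) `[0, b]%classic.
    by apply: (@filterE _ G) => k; rewrite /= in_itv/=; exact: vb.
  have [l [_ cl]] := @segment_compact R 0 b _ _ vG; exists l => U Ul.
  have [//|GU'] := in_ultra_setVsetC ((v^~ i) @^-1` U) GU.
  by have [y [/= yU]] := cl (~` U) U GU' Ul.
pose S m := [set k | (m <= k)%N /\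
  forall i, (pickle i <= m)%N -> `|sval (hl i) - v k i| < m.+1%:R^-1].
have GS m : G (S m).
  have H j : \forall k \near G, forall i : I, (pickle i < j)%N ->
      `|sval (hl i) - v k i| < m.+1%:R^-1.
    elim: j => [|j ih]; first by near=> k.
    case Ej : (unpickle j : option I) => [i|]; last first.
      apply: filterS ih => k h i; rewrite ltnS leq_eqVlt => /predU1P[ij|/h//].
      by move: Ej; rewrite -ij pickleK.
    have : \forall k \near G, `|sval (hl i) - v k i| < m.+1%:R^-1.
      by have /cvgrPdist_lt := svalP (hl i); apply; rewrite invr_gt0.
    apply: filterS2 ih => k h hi i'; rewrite ltnS leq_eqVlt => /predU1P[ij|/h//].
    by move: Ej; rewrite -ij pickleK => -[->].
  have Gm : G [set k | (m <= k)%N] by apply: sG; exists m.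
  by apply: filterS2 Gm (H m.+1) => k mk h; split.
have phiP m : {k | S m k} by apply: cid; exact: filter_ex (GS m).
exists (fun m => sval (phiP m)); split=> [m|i]; first by case: (svalP (phiP m)).
exists (sval (hl i)); apply/cvgrPdist_lt => e e0; near=> m.
have [_ /(_ i)] := svalP (phiP m).
have im : (pickle i <= m)%N by near: m; exact: nbhs_infty_ge.
move=> /(_ im) /lt_trans; apply; near: m; exact: near_infty_natSinv_lt (PosNum e0).
Unshelve. all: by end_near. Qed.

(** The approximation comes from the side of 0, so that [normalized_mono] compares the values at the
    rational point and at the point it approximates. *)
Lemma rat_below (x d : R) : 0 < d ->
  exists q : rat, `|ratr q : R| <= `|x| /\ `|x - ratr q| <= d.
Proof.
move=> d0; have pos (z : R) : 0 < z ->
    exists q : rat, `|ratr q : R| <= `|z| /\ `|z - ratr q| <= d.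
  move=> z0; have : Num.max 0 (z - d) < z by rewrite gt_max z0 ltrBlDr ltrDl.
  move=> /rat_in_itvoo[q]; rewrite in_itv/= gt_max => /andP[/andP[q0 q1] q2].
  exists q; rewrite (gtr0_norm q0) (gtr0_norm z0) gtr0_norm ?subr_gt0//.
  by split; lra.
have [x0|x0|->] := ltgtP x 0.
- have [|q [q1 q2]] := pos (- x); first by rewrite oppr_gt0.
  exists (- q); rewrite raddfN/= normrN -(normrN x); split => //.
  by rewrite -normrN opprD opprK.
- exact: pos.
- by exists 0; rewrite raddf0 subrr normr0 lexx ltW.
Qed.

End selection.

(** * Limits inferior and dominated convergence *)

Section liminf.
Context {R : realType}.
Local Open Scope ereal_scope.
Implicit Types u : (\bar R)^nat.

Definition eliminf u : \bar R := ereal_sup (range (einfs u)).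

Lemma le_eliminf u (c : \bar R) : (\forall m \near \oo, c <= u m) -> c <= eliminf u.
Proof.
move=> [N _ h]; apply: (@le_trans _ _ (einfs u N)); last first.
  by apply: ereal_sup_ubound; exists N.
by apply: le_ereal_inf_tmp => _ [m /= Nm <-]; exact: h.
Qed.

Lemma eliminf_le u (c : \bar R) : (forall m, u m <= c) -> eliminf u <= c.
Proof.
move=> h; apply: ge_ereal_sup => _ [m _ <-]; apply: le_trans (h m).
by apply: ereal_inf_lbound; exists m => /=.
Qed.

Lemma eliminf_lt u (c : \bar R) : eliminf u < c ->
  forall N, exists2 m, (N <= m)%N & u m < c.
Proof.
move=> uc N; have : einfs u N < c.
  by apply: le_lt_trans uc; apply: ereal_sup_ubound; exists N.
by move=> /ereal_inf_lt[_ [m /= Nm <-] ?]; exists m.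
Qed.

Lemma measurable_eliminf d (T : measurableType d) (f_ : nat -> T -> \bar R) :
  (forall k, measurable_fun setT (f_ k)) ->
  measurable_fun setT (fun x => eliminf (f_^~ x)).
Proof.
move=> /measurable_fun_einfs mi.
by apply: (emeasurable_fun_cvg _ _ mi) => x _; exact: cvg_einfs_sup.
Qed.

(** The functions need not converge, but their tail infima increase to the limit inferior at every
    point and keep the minorant [h], so dominated convergence applies to these. *)
Lemma wint_gibbs_liminf d (T : measurableType d)
    (mu : {measure set T -> \bar R}) (rho : T -> R) (a : R)
    (f_ : nat -> T -> \bar R) (h : T -> R) :
  (forall x, (0 <= rho x)%R) -> measurable_fun setT rho -> (0 < a)%R ->
  (forall k, measurable_fun setT (f_ k)) ->
  measurable_fun setT (fun x => (h x)%:E) ->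
  (forall k x, (h x)%:E <= f_ k x) ->
  wint mu rho (gibbs a (fun x => (h x)%:E)) < +oo ->
  wint mu rho (gibbs a (fun x => einfs (f_^~ x) k)) @[k --> \oo] -->
  wint mu rho (gibbs a (fun x => eliminf (f_^~ x))).
Proof.
move=> rho0 mrho a0 mf mh hf hoo.
have mi := measurable_fun_einfs mf.
have ci x : einfs (f_^~ x) k @[k --> \oo] --> eliminf (f_^~ x).
  exact: cvg_einfs_sup.
have ml := measurable_eliminf mf.
apply: (wint_dominated_cvg _ _ _ _ (nonneg_measurable_gibbs a mh)) => //.
- by move=> k; exact: nonneg_measurable_gibbs.
- exact: nonneg_measurable_gibbs.
- move=> k x; rewrite lee_expeR leeN2 lee_pmul2l ?lte_fin//.
  by apply: le_ereal_inf_tmp => _ [m /= _ <-].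
move=> x; apply: expeR_cvg.
  rewrite lteNl; apply: (@lt_le_trans _ _ (a%:E * (h x)%:E)); first by rewrite -EFinM ltNyr.
  by rewrite lee_pmul2l ?lte_fin//; apply: le_eliminf; exact: nearW.
by apply: cvgeN; apply: cvgeZl.
Qed.

End liminf.

(** * The limit functions and the candidate maximiser *)

Section limit_function.
Context {R : realType} {n : nat}.
Local Notation E := 'rV[R]_n.+1.
Local Notation T := (lebesgue_space R n).
Local Notation ratv q := (map_mx ratr q : E).
Variable f_ : nat -> E -> \bar R.
Hypothesis nf : forall k, normalized (f_ k).

Definition liminf_fun (x : E) : \bar R := eliminf (f_^~ x).

Definition liminf_legendre (y : E) : \bar R :=
  eliminf (fun k => legendre (f_ k) y).

Lemma liminf_fun_ge (x : E) : ((`|x| / 2 - 1)%:E <= liminf_fun x)%E.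
Proof.
apply: le_eliminf; apply: nearW => k; apply: le_trans (normalized_ge (nf k) x).
by rewrite lee_fin; have := normr_ge0 x; lra.
Qed.

Lemma liminf_legendre_ge (y : E) : ((`|y| / 2 - 1)%:E <= liminf_legendre y)%E.
Proof.
by apply: le_eliminf; apply: nearW => k; exact: normalized_legendre_ge.
Qed.

Lemma liminf_legendre_gtNy y : (-oo < liminf_legendre y)%E.
Proof. by apply: lt_le_trans (liminf_legendre_ge y); rewrite ltNyr. Qed.

Lemma liminf_legendre_axis i (e : R) : `|e| <= 1 ->
  (liminf_legendre (set_coord i e 0) <= 1)%E.
Proof.
by move=> e1; apply: eliminf_le => k; exact: normalized_legendre_axis.
Qed.

Lemma liminf_legendre_sym : one_symmetric liminf_legendre.
Proof.
have ls k := legendre_one_symmetric (normalized_sym (nf k)).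
split=> [eps y h|sg y]; congr eliminf; apply/funext => k.
  exact: (ls k).1.
exact: (ls k).2.
Qed.

Lemma legendre_liminf_ge i (x : E) : ((`|x 0 i| - 1)%:E <= legendre liminf_legendre x)%E.
Proof.
pose e : R := if 0 <= x 0 i then 1 else -1.
apply: le_trans (legendre_ge _ (set_coord i e 0) x); rewrite dot_set_coord.
have e1 : `|e| <= 1 by rewrite /e; case: ifP => _; rewrite ?normrN normr1.
have -> : e * x 0 i = `|x 0 i|.
  rewrite /e; case: ifPn => [x0|]; first by rewrite ger0_norm// mul1r.
  by rewrite -ltNge => x0; rewrite ltr0_norm// mulN1r.
by rewrite EFinB; apply: leeB => //; exact: liminf_legendre_axis.
Qed.

(** On this ball the pairing with [y] is at most [|y| / 2], which the lower bound [|y| / 2 - 1] of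
    the limit inferior absorbs up to 1. This gives the domain an interior. *)
Lemma legendre_liminf_le1 (x : E) : `|x| <= (2 * n.+1%:R)^-1 ->
  (legendre liminf_legendre x <= 1)%E.
Proof.
move=> xn; apply: legendre_le => y.
apply: (@le_trans _ _ ((`|y| / 2)%:E - (`|y| / 2 - 1)%:E)%E).
  apply: leeB; last exact: liminf_legendre_ge.
  rewrite lee_fin (le_trans (dot_le_norm _ _))// mulrAC -mulrA [leRHS]mulrC.
  rewrite [leRHS](_ : _ = n.+1%:R * ((2 * n.+1%:R)^-1 * `|y|)).
    by rewrite ler_wpM2l// ler_wpM2r.
  by field.
by rewrite -EFinB lee_fin; lra.
Qed.

Lemma legendre_liminf_classC : in_classC (legendre liminf_legendre).
Proof.
have fin : exists x, (liminf_legendre x < +oo)%E.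
  exists (set_coord ord0 1 0); apply: (@le_lt_trans _ _ 1%E); last exact: ltry.
  by apply: liminf_legendre_axis; rewrite normr1.
have sym := legendre_one_symmetric liminf_legendre_sym.
split.
- by move=> x; exact: legendre_gtNy.
- exact: legendre_lsc.
- by move=> x; exact: one_symmetric_even.
- by apply: legendre_convex => //; exact: liminf_legendre_gtNy.
- exists 0; apply/nbhs_ballP; exists (2 * n.+1%:R)^-1 => /=.
    by rewrite invr_gt0 mulr_gt0.
  move=> x; rewrite -ball_normE/= sub0r normrN => /ltW xn.
  by apply: le_lt_trans (legendre_liminf_le1 xn) _; exact: ltry.
(* A point of sup norm below [M + 1] has Euclidean norm at most this radius. *)
move=> M; exists (Num.sqrt (n.+1%:R * (M + 1) ^+ 2)) => x.
rewrite ltNge => /negP xM; have [i xi] := norm_coord_max x.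
apply: le_trans (legendre_liminf_ge i x); rewrite -xi lee_fin.
rewrite leNgt; apply/negP => h; apply: xM; apply: ler_wsqrtr.
apply: (le_trans (dot_le_norm x x)); rewrite -mulrA ler_wpM2l// -expr2.
by rewrite ler_sqr ?nnegrE//; have := normr_ge0 x; lra.
Qed.

(* Young's inequality does not pass to the two liminfs separately; convergence
   at rational points lying coordinatewise below [x] replaces it, by monotonicity. *)
Lemma legendre_liminf_legendre_le :
  (forall q : 'rV[rat]_n.+1, exists l : R,
    fine (expeR (- f_ k (ratv q))) @[k --> \oo] --> l) ->
  forall x, (legendre liminf_legendre x <= liminf_fun x)%E.
Proof.
move=> cq x; apply: legendre_le => y.
move: (liminf_fun_ge x); case Ef : (liminf_fun x) => [f| |]// _; last by rewrite leey.
apply/lee_addgt0Pr => e e0.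
suff : ((dot y x - f - e)%:E <= liminf_legendre y)%E.
  have := liminf_legendre_gtNy y; case: (liminf_legendre y) => [g| |]//= _.
    by rewrite -EFinD !lee_fin; lra.
  by rewrite leNye.
have [q [qx qd]] : exists q : 'rV[rat]_n.+1,
    (forall i, `|ratv q 0 i| <= `|x 0 i|) /\ dot y x - e / 2 <= dot y (ratv q).
  (* Moving each coordinate by at most [d] changes the pairing with [y] by at most [e / 2]; the
     [+ 1] covers [y = 0]. *)
  pose d := e / 2 / (n.+1%:R * `|y| + 1).
  have k0 : 0 < n.+1%:R * `|y| + 1.
    by rewrite ltr_wpDl// mulr_ge0.
  have d0 : 0 < d by rewrite !divr_gt0.
  have hq i := cid (rat_below (x 0 i) d0).
  exists (\row_i sval (hq i)); split=> [i|].
    by rewrite !mxE; case: (svalP (hq i)).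
  rewrite lerBlDl -lerBlDr.
  have -> : dot y x - dot y (ratv (\row_i sval (hq i))) =
      dot y (x - ratv (\row_i sval (hq i))).
    by rewrite !(dotC y) dotDl -[in RHS](scaleN1r (ratv _)) dotZl mulN1r.
  apply: (le_trans (dot_le_norm _ _)).
  apply: (@le_trans _ _ (n.+1%:R * `|y| * d)).
    apply: ler_wpM2l; first by rewrite mulr_ge0.
    apply: norm_le; first exact: ltW.
    by move=> i; rewrite !mxE; case: (svalP (hq i)).
  rewrite /d mulrA ler_pdivrMr// mulrC ler_wpM2l//; last by lra.
  by rewrite divr_ge0// ltW.
(* The limit inferior at [x] gives small values only for infinitely many indices. Monotonicity
   carries them to [q], where convergence of the exponentials turns infinitely many into all large
   indices; the gap between [e / 4] and [e / 2] makes the comparison with the limit strict. *)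
have qlt : \forall k \near \oo, (f_ k (ratv q) <= (f + e / 2)%:E)%E.
  have [l cl] := cq q.
  pose v k := fine (expeR (- f_ k (ratv q))).
  have vE k : (v k)%:E = expeR (- f_ k (ratv q)).
    apply: fineK; rewrite ge0_fin_numE ?expeR_ge0//.
    have := normalized_ge (nf k) (ratv q).
    by case: (f_ k _) => //= r _; rewrite ltry.
  have ll : expR (- (f + e / 4)) <= l.
    rewrite leNgt; apply/negP => ll.
    have [N _ vN] := cvgr_lt _ cl _ ll.
    have [|m Nm fm] := @eliminf_lt _ (f_^~ x) (f + e / 4)%:E _ N.
      by rewrite -/(liminf_fun x) Ef lte_fin; lra.
    have := vN _ Nm; rewrite -/(v m) -lte_fin vE.
    rewrite -[X in (_ < X)%E]/(expeR (- (f + e / 4)%:E)%E) lte_expeR lteN2.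
    rewrite ltNge => /negP; apply; apply: le_trans (ltW fm).
    exact: normalized_mono.
  have l2 : expR (- (f + e / 2)) < l.
    by apply: lt_le_trans ll; rewrite ltr_expR; lra.
  apply: filterS (cvgr_gt _ cl _ l2) => k.
  rewrite -/(v k) -lte_fin vE.
  rewrite -[X in (X < _)%E]/(expeR (- (f + e / 2)%:E)%E) lte_expeR lteN2.
  exact: ltW.
apply: le_eliminf; apply: filterS qlt => k fk.
apply: le_trans (legendre_ge (f_ k) (ratv q) y); rewrite (dotC (ratv q)).
apply: (@le_trans _ _ ((dot y (ratv q))%:E - (f + e / 2)%:E)%E); last exact: leeB.
by rewrite -EFinB lee_fin; lra.
Qed.

End limit_function.

(** * Existence of the maximiser *)

(** Provides a competitor, so that the supremum over normalized functions is not [-oo]. *)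
Lemma normalized_sup_norm (R : realType) (n : nat) :
  normalized (fun x : 'rV[R]_n.+1 => `|x|%:E).
Proof.
have mono (z x : 'rV[R]_n.+1) : (forall i, exists j, `|z 0 i| <= `|x 0 j|) -> `|z| <= `|x|.
  move=> zx; apply: norm_le => // i; have [j zj] := zx i.
  by apply: le_trans zj _; exact: coord_le_norm.
split.
- apply/lower_semicontinuousP => a.
  have -> : [set x : 'rV[R]_n.+1 | a%:E < `|x|%:E]%E =
      (fun x : 'rV[R]_n.+1 => `|x|) @^-1` [set y | y > a].
    by apply/seteqP; split => x /=; rewrite lte_fin.
  by apply: open_comp; [move=> x _; exact: norm_continuous|exact: open_gt].
- split=> [eps x h|sg x]; congr EFin; apply/eqP; rewrite eq_le; apply/andP; split;
    apply: mono => i.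
  + by exists i; rewrite mxE normrM; case: (h i) => ->; rewrite ?normrN normr1 mul1r.
  + by exists i; rewrite mxE normrM; case: (h i) => ->; rewrite ?normrN normr1 mul1r.
  + by exists (sg i); rewrite mxE.
  + by exists (sg^-1 i)%g; rewrite mxE permKV.
- by move=> z x zx; rewrite lee_fin; apply: mono => i; exists i.
- by move=> x; rewrite lee_fin; lra.
- move=> i; rewrite lee_fin; apply: norm_le => // j; rewrite !mxE.
  case: ifP => _; last by rewrite normr0.
  by rewrite ger0_norm ?invr_ge0// invf_le1// ler1n.
Qed.

(** [u k] is the integral for the tail infimum from [k] on, which lies below [h_ k] and so has the
    larger integral. Passing to reals lets powers and products converge by ordinary limit
    theorems. *)
Lemma gibbs_integral_liminf (R : realType) (n : nat) (s a : R)
    (rho : 'rV[R]_n.+1 -> R) (h_ : nat -> 'rV[R]_n.+1 -> \bar R) :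
  weight s rho -> 0 < a -> (forall k, lower_semicontinuous (h_ k)) ->
  (forall k x, (`|x| / 2 - 1)%:E <= h_ k x)%E ->
  exists (u : nat -> R) (l : R), [/\ forall k, 0 <= u k,
    forall k, (gibbs_integral a rho (h_ k) <= (u k)%:E)%E,
    gibbs_integral a rho (fun x => eliminf (h_^~ x)) = l%:E &
    u @ \oo --> l].
Proof.
move=> w a0 hlsc hge.
pose T := lebesgue_space R n.
have mh k : measurable_fun [set: T] (h_ k : T -> \bar R).
  exact: lsc_lebesgue_measurable.
have mi k : measurable_fun [set: T] ((fun x => einfs (h_^~ x) k) : T -> \bar R).
  exact: (measurable_fun_einfs mh).
have ige k x : ((`|x| / 2 - 1)%:E <= einfs (h_^~ x) k)%E.
  by apply: le_ereal_inf_tmp => _ [m _ <-]; exact: hge.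
have cv := wint_gibbs_liminf (weight_ge0 w : forall x : T, 0 <= rho x)
  (weight_measurable w) a0 mh (@measurable_half_norm R n) hge (gibbs_bound_lty w a0).
have bnd (f : 'rV[R]_n.+1 -> \bar R) : measurable_fun [set: T] (f : T -> \bar R) ->
    (forall x, (`|x| / 2 - 1)%:E <= f x)%E ->
    gibbs_integral a rho f \is a fin_num.
  move=> mf fge; rewrite ge0_fin_numE; last exact: gibbs_integral_ge0 w.
  apply: le_lt_trans (gibbs_bound_lty w a0).
  exact: (le_gibbs_integral w a0 (@measurable_half_norm R n) mf fge).
have ml : measurable_fun [set: T] ((fun x => eliminf (h_^~ x)) : T -> \bar R).
  exact: (measurable_eliminf mh).
have finl : gibbs_integral a rho (fun x => eliminf (h_^~ x)) \is a fin_num.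
  by apply: bnd => // x; apply: le_eliminf; exact: nearW.
exists (fun k => fine (gibbs_integral a rho (fun x => einfs (h_^~ x) k))).
exists (fine (gibbs_integral a rho (fun x => eliminf (h_^~ x)))); split.
- by move=> k; apply: fine_ge0; exact: gibbs_integral_ge0 w.
- move=> k; rewrite fineK; last exact: bnd.
  apply: (le_gibbs_integral w a0 (mi k) (mh k)) => x.
  by apply: ereal_inf_lbound; exists k => /=.
- by rewrite fineK.
- by apply: fine_cvg; rewrite fineK.
Qed.

Lemma BS_attains (R : realType) (n : nat) (alpha beta s t : R)
    (rho1 rho2 : 'rV[R]_n.+1 -> R) :
  0 < alpha -> 0 < beta -> weight s rho1 -> weight t rho2 ->
  alpha / beta = (n.+1%:R + s) / (n.+1%:R + t) ->
  exists Phi0 : 'rV[R]_n.+1 -> \bar R,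
    [/\ in_classC Phi0, one_symmetric Phi0,
        BS alpha beta rho1 rho2 Phi0 \is a fin_num
      & forall Phi, normalized Phi ->
          (BS alpha beta rho1 rho2 Phi <= BS alpha beta rho1 rho2 Phi0)%E].
Proof.
move=> a0 b0 w1 w2 ratio; pose bs := BS alpha beta rho1 rho2.
have ai0 : 0 < alpha^-1 by rewrite invr_gt0.
have bi0 : 0 < beta^-1 by rewrite invr_gt0.
have g1 f : (0 <= gibbs_integral alpha rho1 f)%E by exact: gibbs_integral_ge0 w1.
have g2 f : (0 <= gibbs_integral beta rho2 f)%E by exact: gibbs_integral_ge0 w2.
have pm (x x' y y' : \bar R) : (0 <= x)%E -> (0 <= y)%E -> (x <= x')%E -> (y <= y')%E ->
    (x `^ alpha^-1 * y `^ beta^-1 <= x' `^ alpha^-1 * y' `^ beta^-1)%E.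
  move=> x0 y0 xx yy; have x'0 := le_trans x0 xx; have y'0 := le_trans y0 yy.
  apply: lee_pmul; rewrite ?poweR_ge0//.
    by apply: (gt0_ler_poweR (ltW ai0)); rewrite ?in_itv/= ?leey ?andbT.
  by apply: (gt0_ler_poweR (ltW bi0)); rewrite ?in_itv/= ?leey ?andbT.
have bs0 f : (0 <= bs f)%E by rewrite /bs BSE mule_ge0// poweR_ge0.
pose K := (gibbs_bound alpha rho1 `^ alpha^-1 * gibbs_bound beta rho2 `^ beta^-1)%E.
have Koo : (K < +oo)%E.
  have b1 : gibbs_bound alpha rho1 \is a fin_num.
    by rewrite ge0_fin_numE; [exact: gibbs_bound_lty w1 a0|exact: g1].
  have b2 := gibbs_bound_lty w2 b0.
  by rewrite lte_mul_pinfty ?poweR_ge0 ?fin_num_poweR ?poweR_lty.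
have bsK f : normalized f -> (bs f <= K)%E.
  move=> nf; have [h1 h2] := normalized_gibbs_le a0 b0 w1 w2 nf.
  by rewrite /bs BSE; exact: pm.
pose S : set (\bar R) := [set bs f | f in @normalized R n].
have S0 : S (bs (fun x => `|x|%:E)) by exists (fun x => `|x|%:E) => //; exact: normalized_sup_norm.
have Mfin : ereal_sup S \is a fin_num.
  rewrite ge0_fin_numE; last by apply: le_trans (bs0 _) _; exact: ereal_sup_ubound S0.
  apply: le_lt_trans Koo; apply: ge_ereal_sup => _ [f nf <-]; exact: bsK.
have hPhi k : {f | normalized f /\ (ereal_sup S - (k.+1%:R^-1)%:E < bs f)%E}.
  apply: cid; have k0 : (0 : R) < k.+1%:R^-1 by rewrite invr_gt0.
  by have [_ [f nf <-] fk] := ub_ereal_sup_adherent k0 Mfin; exists f.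
pose Phi k := sval (hPhi k).
have nPhi k : normalized (Phi k) by case: (svalP (hPhi k)).
have PhiM k : (ereal_sup S - (k.+1%:R^-1)%:E < bs (Phi k))%E by case: (svalP (hPhi k)).
(* The exponential encodes [+oo] as 0 and, since [Phi k >= -1], keeps all values in a compact
   interval. *)
pose v k (q : 'rV[rat]_n.+1) : R := fine (expeR (- Phi k (map_mx ratr q))).
have vb k q : 0 <= v k q <= expR 1.
  rewrite /v; apply/andP; split; first by apply: fine_ge0; exact: expeR_ge0.
  have := normalized_ge (nPhi k) (map_mx ratr q).
  case: (Phi k _) => [r| |] /=; last by rewrite leeNy_eq.
    by rewrite lee_fin ler_expR; have := normr_ge0 (map_mx ratr q : 'rV[R]_n.+1); lra.
  by move=> _; exact: expR_ge0.
have [phi [phim cphi]] := diagonal_selection vb.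
pose f_ m := Phi (phi m).
have nf m : normalized (f_ m) by exact: nPhi.
have fM m : (ereal_sup S - (m.+1%:R^-1)%:E <= bs (f_ m))%E.
  apply: le_trans (ltW (PhiM (phi m))); apply: leeB => //.
  by rewrite lee_fin lef_pV2 ?posrE// ler_nat ltnS.
have [|k x|u1 [l1 [u10 u1f l1E u1l]]] := gibbs_integral_liminf w1 a0 (h_ := f_).
- by move=> k; exact: normalized_lsc.
- apply: le_trans (normalized_ge (nf k) x).
  by rewrite lee_fin; have := normr_ge0 x; lra.
have [|k y|u2 [l2 [u20 u2f l2E u2l]]] :=
  gibbs_integral_liminf w2 b0 (h_ := fun k => legendre (f_ k)).
- by move=> k; exact: legendre_lsc.
- exact: normalized_legendre_ge.
have l10 : 0 <= l1 by rewrite -lee_fin -l1E.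
have l20 : 0 <= l2 by rewrite -lee_fin -l2E.
have Ml : (ereal_sup S <= (l1 `^ alpha^-1 * l2 `^ beta^-1)%:E)%E.
  have cu : u1 k `^ alpha^-1 * u2 k `^ beta^-1 @[k --> \oo] -->
      l1 `^ alpha^-1 * l2 `^ beta^-1.
    by apply: cvgM; exact: powR_cvg.
  have uM k : fine (ereal_sup S) - k.+1%:R^-1 <= u1 k `^ alpha^-1 * u2 k `^ beta^-1.
    rewrite -lee_fin EFinB fineK//; apply: le_trans (fM k) _.
    by rewrite /bs BSE EFinM -!poweR_EFin; apply: pm.
  have cM : fine (ereal_sup S) - k.+1%:R^-1 @[k --> \oo] --> fine (ereal_sup S) - 0.
    by apply: cvgB; [exact: cvg_cst|exact: cvg_harmonic].
  rewrite -(fineK Mfin) lee_fin -[leLHS]subr0.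
  exact: (ler_cvg_to cM cu (nearW _ uM)).
pose Phi0 := legendre (liminf_legendre f_).
have C0 : in_classC Phi0 by exact: legendre_liminf_classC.
have sym0 : one_symmetric Phi0.
  exact: legendre_one_symmetric (liminf_legendre_sym nf).
have leF : forall x, (Phi0 x <= liminf_fun f_ x)%E.
  by apply: legendre_liminf_legendre_le => // q; exact: cphi.
pose T := lebesgue_space R n.
have mF : measurable_fun [set: T] (liminf_fun f_ : T -> \bar R).
  by apply: (@measurable_eliminf R _ T f_) => k; apply: lsc_lebesgue_measurable;
    exact: normalized_lsc.
have mg : measurable_fun [set: T] (liminf_legendre f_ : T -> \bar R).
  by apply: (@measurable_eliminf R _ T (fun k => legendre (f_ k))) => k;
    apply: lsc_lebesgue_measurable; exact: legendre_lsc.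
have MPhi0 : (ereal_sup S <= bs Phi0)%E.
  apply: (le_trans Ml); rewrite /bs BSE EFinM -!poweR_EFin -l1E -l2E; apply: pm => //.
    exact: (le_gibbs_integral w1 a0
      (lsc_lebesgue_measurable (classC_lsc C0)) mF leF).
  exact: (le_gibbs_integral w2 b0
    (lsc_lebesgue_measurable (@legendre_lsc R n Phi0)) mg (legendre_legendre_le _)).
exists Phi0; split; [exact: C0|exact: sym0| |].
  (* The bound [K] is proved for normalized functions, so it is applied to a normalized rescaling of
     [Phi0] with the same value of the functional. *)
  have [l [c [l0 nl]]] := normalization C0 sym0.
  rewrite ge0_fin_numE; last exact: bs0.
  apply: le_lt_trans Koo; rewrite -(BS_affine a0 b0 w1 w2 ratio c (classC_lsc C0) l0).
  exact: bsK.
by move=> f fn; apply: le_trans MPhi0; apply: ereal_sup_ubound; exists f.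
Qed.

Theorem theorem5p8 (R : realType) (n : nat) (alpha beta s t : R)
    (rho1 rho2 : 'rV[R]_n.+1 -> R)
    (alpha_gt0 : 0 < alpha) (beta_gt0 : 0 < beta)
    (rho1_ge0 : forall x, 0 <= rho1 x) (rho2_ge0 : forall x, 0 <= rho2 x)
    (rho1_int : locally_integrableE rho1) (rho2_int : locally_integrableE rho2)
    (rho1_hom : homogeneous s rho1) (rho2_hom : homogeneous t rho2)
    (s_gt : - n.+1%:R < s) (t_gt : - n.+1%:R < t)
    (ratio : alpha / beta = (n.+1%:R + s) / (n.+1%:R + t)) :
  exists Phi0 : 'rV[R]_n.+1 -> \bar R,
    [/\ in_classC Phi0, one_symmetric Phi0,
        BS alpha beta rho1 rho2 Phi0 \is a fin_num
      & forall Phi : 'rV[R]_n.+1 -> \bar R,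
          in_classC Phi -> one_symmetric Phi ->
          (BS alpha beta rho1 rho2 Phi <= BS alpha beta rho1 rho2 Phi0)%E].
Proof.
have w1 := Weight rho1_ge0 rho1_int rho1_hom s_gt.
have w2 := Weight rho2_ge0 rho2_int rho2_hom t_gt.
have [Phi0 [C0 sym0 fin0 max0]] := BS_attains alpha_gt0 beta_gt0 w1 w2 ratio.
exists Phi0; split; [exact: C0|exact: sym0|exact: fin0|move=> Phi CPhi symPhi].
have [l [c [l0 nPhi]]] := normalization CPhi symPhi.
rewrite -(BS_affine alpha_gt0 beta_gt0 w1 w2 ratio c (classC_lsc CPhi) l0).
exact: max0.
Qed.
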